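(* Let $\alpha,\beta$ be fixed with $0\le\alpha<1$ and $0<\alpha+\beta\le 1$, and consider the multiple blocks model $$X_i=\mu\,\mathbf 1_{\bigcup_{g=1}^m I_g}(i)+Z_i,\qquad i=1,\dots,n,$$ with $m=n^{1-\alpha-\beta}$ randomly located, mutually disjoint intervals $I_g$ of length $|I_g|=n^{\alpha}$ and $Z_i$ i.i.d. standard normal. Consider testing $H_0:\mu=0$ versus $H_1:\mu=\mu(n)>0$. (i) (Sparse case) If $\frac{\beta}{1-\alpha}>\frac12$, let $\mu(n)=\sqrt{2r\log n}/\sqrt{n^{\alpha}}$ with $r>0$ and $$\rho^*(\alpha,\beta)=\begin{cases}\beta-(1-\alpha)/2 & \text{if }\beta/(1-\alpha)<\tfrac34,\\ \bigl(\sqrt{1-\alpha}-\sqrt{1-\alpha-\beta}\bigr)^2 & \text{if }\beta/(1-\alpha)\ge\tfrac34.\end{cases}$$ (ii) (Dense case) If $\frac{\beta}{1-\alpha}<\frac12$, let $\mu(n)=n^{r}/\sqrt{n^{\alpha}}$ and $\rho^*(\alpha,\beta)=\beta-\frac{1-\alpha}{2}$. In either case, if $r<\rho^*(\alpha,\beta)$, then $H_0$ and $H_1$ merge asymptotically, i.e. the sum of the Type I and Type II error probabilities tends to $1$ as $n\to\infty$ for any (sequence of) test(s).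
   Context: Here $r$ is a fixed real constant. Intervals are sets of consecutive integers in $\{1,\dots,n\}$ and $|I|$ is the number of integers in $I$. The configuration $(I_1,\dots,I_m)$ is random (drawn uniformly at random among all configurations of $m$ mutually disjoint intervals of length $n^\alpha$ in $\{1,\dots,n\}$) and independent of the $Z_i$; probabilities under $H_1$ include this randomness. The quantities $n^{\alpha}$ and $n^{1-\alpha-\beta}$ are treated as integers, and it is understood that the blocks fit into $\{1,\dots,n\}$, i.e. $m n^\alpha=n^{1-\beta}\le n$. $\log$ is the natural logarithm. A test is a (possibly randomized) decision rule based on $(X_1,\dots,X_n)$; the constants $\alpha,\beta,r$ may be known to it. *)

(* Defs.v *)
From HB Require Import structures.
From mathcomp Require Export all_boot all_order all_algebra.
From mathcomp Require Export all_classical all_reals all_analysis.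
Export Order.TTheory GRing.Theory Num.Theory.
Export numFieldNormedType.Exports.

Set Implicit Arguments.
Unset Strict Implicit.
Unset Printing Implicit Defensive.

Local Open Scope classical_set_scope.
Local Open Scope ring_scope.

(* [k] is [x] rounded up or down to an adjacent integer; in particular
   [k%:R = x] whenever [x] is a natural number. *)
Definition rounds {R : realType} (k : nat) (x : R) : Prop := `|k%:R - x| < 1.

(* The index [i : 'I_n] stands for the integer [i + 1] of {1, ..., n}. *)
Definition is_interval_of_integers {n : nat} (A : {set 'I_n}) : bool :=
  [exists a : 'I_n.+1, exists b : 'I_n.+1, A == [set i : 'I_n | (a <= i < b)%N]%SET].

Definition block_configs (n m ell : nat) : {set {ffun 'I_m -> {set 'I_n}}} :=
  [set c : {ffun 'I_m -> {set 'I_n}} |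
    [forall g, is_interval_of_integers (c g) && (#|c g| == ell)] &&
    [forall g, forall h, (g != h) ==> [disjoint c g & c h]]]%SET.

Definition mutually_independent {d} {T : measurableType d} {R : realType}
    (P : probability T R) {n : nat} (Z : 'I_n -> {RV P >-> R}) : Prop :=
  forall (J : {set 'I_n}) (B : 'I_n -> set R),
    (forall i, measurable (B i)) ->
    P [set w | forall i, i \in J -> B i (Z i w)] =
      (\prod_(i in J) P (Z i @^-1` B i))%E.

(* [Z] is the noise vector and [I w] the family of blocks (I_1, ..., I_m). *)
Record multiple_blocks_model {d} {T : measurableType d} {R : realType}
    (P : probability T R) {n m : nat} (ell : nat) (Z : 'I_n -> {RV P >-> R})
    (I : T -> {ffun 'I_m -> {set 'I_n}}) : Prop := MultipleBlocksModel {
  noise_std_normal : forall i (B : set R), measurable B ->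
    distribution P (Z i) B = normal_prob 0 1 B ;
  noise_independent : mutually_independent Z ;
  blocks_measurable : forall c, measurable (I @^-1` [set c]) ;
  blocks_uniform : forall c, P (I @^-1` [set c]) =
    (if c \in block_configs n m ell
     then (#|block_configs n m ell|%:R^-1)%:E else 0%E) ;
  blocks_independent_noise : forall c (B : set (n.-tuple R)), measurable B ->
    P (I @^-1` [set c] `&` [set w | B [tuple Z i w | i < n]]) =
      (P (I @^-1` [set c]) * P [set w | B [tuple Z i w | i < n]])%E
}.

Definition observation {d} {T : measurableType d} {R : realType}
    {P : probability T R} {n m : nat} (Z : 'I_n -> {RV P >-> R})
    (I : T -> {ffun 'I_m -> {set 'I_n}}) (mu : R) (w : T) : n.-tuple R :=
  [tuple mu * (i \in (\bigcup_(g < m) I w g)%SET)%:R + Z i w | i < n].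

(* A randomized test: [phi x] is the probability of rejecting H_0 given the
   observation [x]. *)
Definition is_test {R : realType} {n : nat} (phi : n.-tuple R -> R) : Prop :=
  measurable_fun [set: n.-tuple R] phi /\ forall x, 0 <= phi x <= 1.

Definition type1_error {d} {T : measurableType d} {R : realType}
    {P : probability T R} {n m : nat} (Z : 'I_n -> {RV P >-> R})
    (I : T -> {ffun 'I_m -> {set 'I_n}}) (phi : n.-tuple R -> R) : \bar R :=
  'E_P[fun w => phi (observation Z I 0 w)%R]%E.

Definition type2_error {d} {T : measurableType d} {R : realType}
    {P : probability T R} {n m : nat} (Z : 'I_n -> {RV P >-> R})
    (I : T -> {ffun 'I_m -> {set 'I_n}}) (mu : R)
    (phi : n.-tuple R -> R) : \bar R :=
  'E_P[fun w => (1 - phi (observation Z I mu w))%R]%E.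

Definition merge_asymptotically {R : realType} {d : nat -> measure_display}
    {T : forall n, measurableType (d n)} {P : forall n, probability (T n) R}
    {m : nat -> nat} (Z : forall n, 'I_n -> {RV (P n) >-> R})
    (I : forall n, T n -> {ffun 'I_(m n) -> {set 'I_n}}) (mu : nat -> R) : Prop :=
  forall phi : forall n, n.-tuple R -> R,
    (forall n, is_test (phi n)) ->
    (type1_error (Z n) (@I n) (phi n) + type2_error (Z n) (@I n) (mu n) (phi n))%E
      @[n --> \oo] --> (1%:E : \bar R).

Definition mu_sparse {R : realType} (alpha r : R) (n : nat) : R :=
  Num.sqrt (2 * r * ln n%:R) / Num.sqrt (n%:R `^ alpha).

Definition mu_dense {R : realType} (alpha r : R) (n : nat) : R :=
  n%:R `^ r / Num.sqrt (n%:R `^ alpha).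

Definition rho_sparse {R : realType} (alpha beta : R) : R :=
  if beta / (1 - alpha) < 3 / 4 then beta - (1 - alpha) / 2
  else (Num.sqrt (1 - alpha) - Num.sqrt (1 - alpha - beta)) ^+ 2.

Definition rho_dense {R : realType} (alpha beta : R) : R :=
  beta - (1 - alpha) / 2.

(* Main.v *)
From HB Require Import structures.
Require Import Defs.
From mathcomp Require Import ring lra zify measurable_realfun.

Set Implicit Arguments.
Unset Strict Implicit.
Unset Printing Implicit Defensive.

(** Let E0 denote expectation under pure noise and let L be the likelihood ratio
    averaged over the equally likely configurations.  The two errors of a test
    phi add up to 1 + E0 (phi (1 - L)), so the hypotheses merge as soon as L
    tends to 1 in L1 under E0.  When E0 L^2 tends to 1 this follows from a
    variance bound, and that is what happens for r below beta - (1 - alpha)/2.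
    For sparser signals E0 L^2 is dominated by rare events on which one block
    sum is huge.  There the likelihood ratio L_c of each configuration c is
    first multiplied by the indicator that every block sum of c is at most a
    threshold tau.  The mass lost is the probability under H1 that some block
    sum exceeds tau, a union bound over m Gaussian tails ([truncation_loss]),
    and the truncated second moment controls what is left
    ([truncated_second_moment_bound]).

    The truncated second moment is an average over two configurations c, c'.
    Keep the truncation for c only.  The blocks of c are disjoint, so for a
    fixed c' the expectation factors over the blocks of c: a block that misses
    all of c' contributes at most 1, and a block that meets c' at most 1 + V
    ([second_moment_pair]).  Since the indicator of X <= tau is at most
    exp (lam (tau - X)), only exponential moments of linear forms in the noise
    occur, and these come from the change of measure [gaussian_shift].  For
    lam <= mu the bound increases with the overlap, so complete overlap is the
    worst case however the blocks of c and c' are aligned.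

    The blocks are neither aligned to a grid nor independent, so the average
    over c of the product of the factors 1 + V needs an argument: the
    probability that k given blocks of c all meet c' is at most
    (2 m ell / (n - m ell + 1))^k.  Indeed, deleting a block at a known position
    and closing the gap turns a placement in n cells into a placement of one
    block less in n - ell cells, and each of the latter has at least
    n - m ell + 1 slots into which a block can be inserted
    ([card_placements_hit]).  Expanding the product, the average is at most
    (1 + 2 m ell V / (n - m ell + 1))^m ([config_product_moment]).

    It remains to choose tau and lam.  Write a = 1 - alpha and
    b = 1 - alpha - beta, so that m is of order n^b and n / ell of order n^a.
    Without truncation (lam = 0) the exponent of n in the excess second moment
    is 2 b - a + 2 r.  With tau = sqrt (2 a ell log n) and
    lam = (2 mu ell - tau) / ell it is 2 (b - (sqrt a - sqrt r)^2), twice the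
    exponent of the truncation loss.  Below the detection boundary one of the
    two choices makes these exponents negative. *)

(** * Counting placements of disjoint blocks *)

Section Placements.
Local Open Scope nat_scope.
Local Open Scope set_scope.

Lemma card_itv_ord n a b : #|[set p : 'I_n | a <= p < b]| = minn b n - a.
Proof.
rewrite cardE -(size_map val) -[RHS](size_iota a); apply: perm_size.
apply: uniq_perm; rewrite ?iota_uniq ?(map_inj_uniq val_inj) ?enum_uniq//.
move=> x; rewrite mem_iota; apply/mapP/idP => [[p]|xab].
  by rewrite mem_enum inE => + -> /=; have := ltn_ord p; lia.
have xn : x < n by lia.
by exists (Ordinal xn) => //; rewrite mem_enum inE /=; lia.
Qed.

Lemma card_bigcup_leq (J U : finType) (X : J -> {set U}) :
  #|\bigcup_j X j| <= \sum_j #|X j|.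
Proof.
elim/big_rec2: _ => [|j k A _ IH]; first by rewrite cards0.
by apply: leq_trans (leq_card_setU _ _) _; rewrite leq_add2l.
Qed.

Variables (M ell : nat).
Hypothesis ell0 : 0 < ell.

(** A placement of [m] blocks is recorded by their starting points.  The ambient
    size [N] shrinks when blocks are deleted while the type ['I_M.+1] of starting
    points stays fixed, so that no dependent casts arise. *)
Definition placements (N m : nat) : {set {ffun 'I_m -> 'I_M.+1}} :=
  [set s : {ffun 'I_m -> 'I_M.+1} | [forall g, s g + ell <= N] &&
    [forall g, forall h, (g != h) ==> ((s g + ell <= s h) || (s h + ell <= s g))]].

Lemma placementsP N m (s : {ffun 'I_m -> 'I_M.+1}) :
  reflect ((forall g, s g + ell <= N) /\
           (forall g h, g != h -> s g + ell <= s h \/ s h + ell <= s g))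
          (s \in placements N m).
Proof.
rewrite inE; apply: (iffP andP) => -[H1 H2]; split.
- exact/forallP.
- by move=> g h gh; move/forallP/(_ g)/forallP/(_ h)/implyP/(_ gh)/orP: H2.
- exact/forallP.
- by apply/forallP => g; apply/forallP => h; apply/implyP => gh; apply/orP; exact: H2.
Qed.

(** The position, after a block has been inserted at [p], of what was at [q]. *)
Definition make_room (p q : 'I_M.+1) : 'I_M.+1 :=
  inord (if q < p then q : nat else q + ell).

Definition close_room (p q : 'I_M.+1) : 'I_M.+1 :=
  inord (if q < p then q : nat else q - ell).

Lemma make_roomE (p q : 'I_M.+1) : q + ell <= M ->
  make_room p q = (if q < p then q : nat else q + ell) :> nat.
Proof. by move=> qM; rewrite /make_room inordK//; case: ifP; lia. Qed.

Lemma close_roomE (p q : 'I_M.+1) :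
  close_room p q = (if q < p then q : nat else q - ell) :> nat.
Proof. by rewrite /close_room inordK//; have := ltn_ord q; case: ifP; lia. Qed.

Lemma make_room_inj (p q1 q2 : 'I_M.+1) : q1 + ell <= M -> q2 + ell <= M ->
  make_room p q1 = make_room p q2 -> q1 = q2.
Proof.
move=> h1 h2 /(congr1 (@nat_of_ord _)); rewrite !make_roomE// => h.
by apply: ord_inj; move: h; do 2 case: ifP; lia.
Qed.

Definition insert_block m (k : 'I_m.+1) (p : 'I_M.+1) (s : {ffun 'I_m -> 'I_M.+1}) :
    {ffun 'I_m.+1 -> 'I_M.+1} :=
  [ffun g => if unlift k g is Some h then make_room p (s h) else p].

Definition free_slots (N m : nat) (s : {ffun 'I_m -> 'I_M.+1}) : {set 'I_M.+1} :=
  [set p : 'I_M.+1 | (p + ell <= N) && [forall h, (p <= s h) || (s h + ell <= p)]].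

(** Each block forbids fewer than [ell] of the [N - ell + 1] conceivable slots. *)
Lemma card_free_slots N m (s : {ffun 'I_m -> 'I_M.+1}) :
  N <= M -> m.+1 * ell <= N -> N - m.+1 * ell + 1 <= #|free_slots N s|.
Proof.
rewrite mulSn => NM mN.
pose W := [set p : 'I_M.+1 | p + ell <= N].
pose X h := [set p : 'I_M.+1 | s h < p < s h + ell].
have cW : #|W| = N - ell + 1.
  rewrite (_ : W = [set p : 'I_M.+1 | 0 <= p < N - ell + 1]).
    by rewrite card_itv_ord; lia.
  by apply/setP => p; rewrite !inE; lia.
have sub : W \subset free_slots N s :|: \bigcup_h X h.
  apply/fintype.subsetP => p; rewrite !inE => pN; rewrite pN /=.
  case: (boolP [forall h, _]) => //= /forallPn[h]; rewrite negb_or => hh.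
  by apply/bigcupP; exists h => //; rewrite inE; lia.
have cX : #|\bigcup_h X h| <= m * ell.
  apply: (leq_trans (card_bigcup_leq _)).
  rewrite -[X in X * _]card_ord -sum_nat_const; apply: leq_sum => h _.
  by rewrite card_itv_ord; lia.
have := leq_trans (subset_leq_card sub) (leq_card_setU _ _).
rewrite {}cW; move: cX mN; move: #|_| #|_| (m * ell) => c f ml; lia.
Qed.

Lemma insert_block_placement N m (k : 'I_m.+1) (p : 'I_M.+1)
    (s : {ffun 'I_m -> 'I_M.+1}) :
  N <= M -> ell <= N -> s \in placements (N - ell) m -> p \in free_slots N s ->
  insert_block k p s \in placements N m.+1.
Proof.
move=> NM lN /placementsP[sN sd]; rewrite inE => /andP[pN /forallP ps].
have sM h : s h + ell <= M by have := sN h; lia.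
apply/placementsP; split=> [g|g h gh]; rewrite !ffunE.
  case: unliftP => [j _|_] //.
  by rewrite make_roomE//; have := sN j; case: ifP; lia.
case: unliftP gh => [j ->|->]; case: unliftP => [i ->|->] gh.
- have ji : j != i by apply: contra_neq gh => ->.
  have := sd _ _ ji; rewrite !make_roomE//; have := ps j; have := ps i.
  by do 2 case: ifP; lia.
- by rewrite make_roomE//; have := ps j; case: ifP; lia.
- by rewrite make_roomE//; have := ps i; case: ifP; lia.
- by rewrite eqxx in gh.
Qed.

(** Different pairs of a placement and a free slot give different placements
    after insertion of the new block, under the label [ord0]. *)
Lemma placements_grow N m : N <= M -> m.+1 * ell <= N ->
  (N - m.+1 * ell + 1) * #|placements (N - ell) m| <= #|placements N m.+1|.
Proof.
move=> NM mN.
have lN : ell <= N by move: mN; rewrite mulSn; lia.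
pose D := [set x : {ffun 'I_m -> 'I_M.+1} * 'I_M.+1 |
            (x.1 \in placements (N - ell) m) && (x.2 \in free_slots N x.1)].
pose F (x : {ffun 'I_m -> 'I_M.+1} * 'I_M.+1) := insert_block ord0 x.2 x.1.
have injF : {in D &, injective F}.
  move=> [s p] [t q].
  rewrite inE /= => /andP[/placementsP[sp _] _].
  rewrite inE /= => /andP[/placementsP[tp _] _] /ffunP E.
  have pq : p = q by have := E ord0; rewrite !ffunE unlift_none.
  rewrite -pq in E *; congr (_, _); apply/ffunP => h.
  have := E (lift ord0 h); rewrite !ffunE liftK; apply: make_room_inj.
    by have /= := sp h; lia.
  by have /= := tp h; lia.
have cD : (N - m.+1 * ell + 1) * #|placements (N - ell) m| <= #|D|.
  rewrite -[X in _ <= X]sum1_card (eq_bigl (fun x : {ffun 'I_m -> 'I_M.+1} * 'I_M.+1 =>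
    (x.1 \in placements (N - ell) m) && (x.2 \in free_slots N x.1))); last first.
    by move=> x; rewrite inE.
  rewrite -(pair_big_dep (fun s => s \in placements (N - ell) m)
    (fun s p => p \in free_slots N s) (fun _ _ => 1))/=.
  rewrite mulnC -sum_nat_const; apply: leq_sum => s _.
  by rewrite sum1_card; exact: card_free_slots.
apply: leq_trans cD _; rewrite -(card_in_imset injF); apply/subset_leq_card.
apply/fintype.subsetP => _ /imsetP[[s p] + ->]; rewrite inE /= => /andP[? ?].
exact: insert_block_placement.
Qed.

(** Under a uniform placement, the probability that each block with label in [K]
    starts in a prescribed set of [a] points is at most
    (a / (N - m ell + 1))^|K|, as if the blocks were independent and uniform
    over N - m ell + 1 positions.  Induction on [m]: fix the position p of one
    block of [K], delete it and close the gap.  The prescribed sets of the other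
    blocks do not grow under this operation, N - m ell does not change, and
    [placements_grow] pays for the block deleted. *)
Lemma card_placements_hit m : forall N (K : {set 'I_m}) (A : 'I_m -> {set 'I_M.+1}) a,
  N <= M -> m * ell <= N -> (forall g, #|A g| <= a) ->
  (N - m * ell + 1) ^ #|K| * #|[set s in placements N m | [forall g in K, s g \in A g]]|
    <= a ^ #|K| * #|placements N m|.
Proof.
elim: m => [|m IH] N K A a NM mN Aa.
  rewrite (_ : K = finset.set0) ?cards0 ?expn0 ?mul1n; last by apply/setP => -[].
  by apply/subset_leq_card/fintype.subsetP => s; rewrite inE => /andP[].
have [->|[k kK]] := set_0Vmem K.
  rewrite cards0 !expn0 !mul1n.
  by apply/subset_leq_card/fintype.subsetP => s; rewrite inE => /andP[].
have lN : ell <= N by move: mN; rewrite mulSn; lia.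
have mN' : m * ell <= N - ell by move: mN; rewrite mulSn; lia.
have DE : N - m.+1 * ell = N - ell - m * ell by rewrite mulSn subnDA.
set D := N - m.+1 * ell + 1.
pose K' := [set h | lift k h \in K].
have cK : #|K| = #|K'|.+1.
  rewrite (cardsD1 k) kK add1n; congr _.+1.
  rewrite -(card_imset K' (@lift_inj _ k)); apply: eq_card => g; rewrite !inE.
  apply/andP/imsetP => [[gk gK]|[h + ->]].
    by case: (unliftP k g) gk gK => [h ->|->]; rewrite ?eqxx// => _ hK; exists h; rewrite ?inE.
  by rewrite inE => hK; split=> //; rewrite eq_sym neq_lift.
pose A' p h := [set q : 'I_M.+1 | (q + ell <= M) && (make_room p q \in A (lift k h))].
have A'a p h : #|A' p h| <= a.
  apply: leq_trans (Aa (lift k h)).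
  rewrite -(@card_in_imset _ _ (make_room p) (A' p h)); last first.
    move=> q1 q2; rewrite !inE => /andP[h1 _] /andP[h2 _]; exact: make_room_inj.
  by apply/subset_leq_card/fintype.subsetP => _ /imsetP[q + ->]; rewrite inE => /andP[].
set S := [set s in placements N m.+1 | _].
pose S' p := [set s in placements (N - ell) m | [forall g in K', s g \in A' p g]].
(* With block [k] at [p], deleting it loses no information. *)
have step p : #|[set s in S | s k == p]| <= #|S' p|.
  pose C (s : {ffun 'I_m.+1 -> 'I_M.+1}) := [ffun h => close_room p (s (lift k h))].
  have SP s : s \in [set s in S | s k == p] -> [/\ s k = p, s \in placements N m.+1,
      forall h, make_room p (C s h) = s (lift k h) & C s \in S' p].
    move=> sSp.
    have [sS /eqP skp] : s \in S /\ s k == p by move: sSp; rewrite inE => /andP[].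
    have [sp /forallP sK] : s \in placements N m.+1 /\ [forall g in K, s g \in A g].
      by move: sS; rewrite inE => /andP[].
    have /placementsP[sN sd] := sp.
    pose t h : nat := s (lift k h).
    have tN h : t h + ell <= N := sN (lift k h).
    have pN : p + ell <= N by rewrite -skp; exact: sN.
    have pd h : t h + ell <= p \/ p + ell <= t h.
      by rewrite -skp; apply: sd; rewrite eq_sym neq_lift.
    have CE h : C s h = (if t h < p then t h else t h - ell) :> nat.
      by rewrite ffunE close_roomE.
    have CN h : C s h + ell <= N - ell.
      by have := tN h; have := pd h; rewrite CE; case: ifP; lia.
    have CM h : C s h + ell <= M by apply: leq_trans (CN h) _; lia.
    have rE h : make_room p (C s h) = s (lift k h).
      apply: ord_inj; rewrite -/(t h) make_roomE// CE.
      by have := tN h; have := pd h; do ?case: ifP; lia.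
    split; [by []|by []|exact: rE|].
    rewrite inE; apply/andP; split.
      apply/placementsP; split=> [h|g h gh]; first exact: CN.
      have : lift k g != lift k h by apply: contra_neq gh => /lift_inj.
      move=> /sd; rewrite -/(t g) -/(t h).
      by have := pd g; have := pd h; rewrite !CE; do 2 case: ifP; lia.
    apply/forallP => h; apply/implyP; rewrite !inE => hK; rewrite rE.
    by rewrite (implyP (sK _) hK) andbT CM.
  rewrite -(@card_in_imset _ _ C [set s in S | s k == p]); last first.
    move=> s t /SP[sk _ sr _] /SP[tk _ tr _] E; apply/ffunP => g.
    by case: (unliftP k g) => [h ->|->]; [rewrite -sr -tr E|rewrite sk tk].
  by apply/subset_leq_card/fintype.subsetP => _ /imsetP[s /SP[_ _ _ ?] ->].
have cS : #|S| <= \sum_(p in A k) #|S' p|.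
  apply: (@leq_trans (\sum_(p in A k) #|[set s in S | s k == p]|)); last exact: leq_sum.
  rewrite -sum1_card
    (partition_big (fun s : {ffun 'I_m.+1 -> 'I_M.+1} => s k) (mem (A k))) /=.
    apply: leq_sum => p _; rewrite -sum1_card; apply: eq_leq.
    by apply: eq_bigl => s; rewrite !inE.
  by move=> s; rewrite inE => /andP[_ /forallP/(_ k)]; rewrite kK.
have IHp p : D ^ #|K'| * #|S' p| <= a ^ #|K'| * #|placements (N - ell) m|.
  by rewrite /D DE; apply: IH => //; lia.
have gr : D * #|placements (N - ell) m| <= #|placements N m.+1| by exact: placements_grow.
rewrite cK !expnS.
apply: (@leq_trans (D * \sum_(p in A k) D ^ #|K'| * #|S' p|)).
  by rewrite -big_distrr/= mulnA leq_mul2l cS orbT.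
apply: (@leq_trans (D * (a * (a ^ #|K'| * #|placements (N - ell) m|)))).
  rewrite leq_mul2l; apply/orP; right.
  apply: (@leq_trans (\sum_(p in A k) a ^ #|K'| * #|placements (N - ell) m|)).
    by apply: leq_sum => p _; exact: IHp.
  by rewrite sum_nat_const leq_mul2r Aa orbT.
rewrite (_ : D * _ = a * a ^ #|K'| * (D * #|placements (N - ell) m|)); last by ring.
by rewrite leq_mul2l gr orbT.
Qed.

End Placements.

(** * Averages over block configurations *)

Section Configs.
Local Open Scope nat_scope.
Local Open Scope set_scope.

Variables (n ell : nat).
Hypothesis ell0 : 0 < ell.

Definition block_at (p : 'I_n.+1) : {set 'I_n} := [set i : 'I_n | p <= i < p + ell].

Definition config_of m (s : {ffun 'I_m -> 'I_n.+1}) : {ffun 'I_m -> {set 'I_n}} :=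
  [ffun g => block_at (s g)].

Lemma block_at_disjoint (p q : 'I_n.+1) : p + ell <= n -> q + ell <= n ->
  [disjoint block_at p & block_at q] = (p + ell <= q) || (q + ell <= p).
Proof.
move=> pn qn; apply/idP/idP => [dis|sep].
  apply/negPn/negP => /norP[h1 h2].
  have in1 : maxn p q < n by lia.
  have := disjointFr dis (x := Ordinal in1); rewrite !inE /= => /(_ _).
  have -> : (p <= maxn p q < p + ell) by lia.
  have -> : (q <= maxn p q < q + ell) by lia.
  by move=> /(_ isT).
apply/pred0P => i; rewrite /= !inE; apply/negbTE/negP; move: sep.
by move: (nat_of_ord i) (nat_of_ord p) (nat_of_ord q) => a b c; lia.
Qed.

Lemma card_block_at (p : 'I_n.+1) : p + ell <= n -> #|block_at p| = ell.
Proof. by move=> pn; rewrite card_itv_ord; lia. Qed.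

Lemma block_at_inj (p q : 'I_n.+1) : p + ell <= n -> q + ell <= n ->
  block_at p = block_at q -> p = q.
Proof.
move=> pn qn /setP H.
have pn' : p < n by lia.
have qn' : q < n by lia.
have := H (Ordinal pn'); have := H (Ordinal qn'); rewrite !inE /= => h1 h2.
by apply: ord_inj; lia.
Qed.

Lemma block_configsE m : block_configs n m ell = @config_of m @: placements n ell n m.
Proof.
apply/setP => c; rewrite inE; apply/andP/imsetP => [[/forallP ci /forallP cd]|[s sp ->]].
  have ex g : exists p : 'I_n.+1, p + ell <= n /\ c g = block_at p.
    have /andP[/existsP[a /existsP[b /eqP cg]] /eqP cl] := ci g.
    move: cl; rewrite cg card_itv_ord => cl.
    have bn := ltn_ord b.
    exists a; split; first lia.
    by apply/setP => i; rewrite !inE; have := ltn_ord i; lia.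
  have [s Hs] := fin_all_exists ex.
  have E : c = config_of [ffun g => s g].
    by apply/ffunP => g; rewrite !ffunE; have [] := Hs g.
  exists [ffun g => s g] => //.
  apply/placementsP; split=> [g|g h gh]; rewrite !ffunE; first by have [] := Hs g.
  have [gn cg] := Hs g; have [hn ch] := Hs h.
  have := cd g => /forallP/(_ h)/implyP/(_ gh).
  by rewrite cg ch block_at_disjoint// => /orP.
have /placementsP[sn sd] := sp.
split; apply/forallP => g.
  rewrite ffunE; apply/andP; split.
    have gn : s g + ell < n.+1 by have h : (s g + ell <= n) := sn g; lia.
    by apply/existsP; exists (s g); apply/existsP; exists (Ordinal gn).
  by rewrite card_block_at.
apply/forallP => h; apply/implyP => gh; rewrite !ffunE.
by rewrite block_at_disjoint//; apply/orP; exact: sd.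
Qed.

Lemma config_of_inj m : {in placements n ell n m &, injective (@config_of m)}.
Proof.
move=> s t /placementsP[sn _] /placementsP[tn _] /ffunP E.
by apply/ffunP => g; have := E g; rewrite !ffunE; exact: block_at_inj.
Qed.

(** A block of length [ell] meets another one only if their starting points
    differ by less than [ell]; hence the factor 2. *)
Lemma card_hitting m (c : {ffun 'I_m -> {set 'I_n}}) : c \in block_configs n m ell ->
  #|[set p : 'I_n.+1 | (p + ell <= n) && ~~ [disjoint block_at p & \bigcup_g c g]]|
    <= 2 * (m * ell).
Proof.
rewrite block_configsE => /imsetP[s /placementsP[sn _] ->].
set A := [set p | _].
have sub : A \subset \bigcup_(g : 'I_m) [set p : 'I_n.+1 | (s g).+1 - ell <= p < s g + ell].
  apply/fintype.subsetP => p; rewrite inE => /andP[pn /pred0Pn[i /andP[/= ip]]].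
  move=> /bigcupP[g _]; rewrite ffunE => ig; apply/bigcupP; exists g => //.
  by move: ip ig; rewrite !inE; lia.
apply: leq_trans (subset_leq_card sub) _.
apply: leq_trans (card_bigcup_leq _) _.
rewrite mulnCA -[X in X * _]card_ord -sum_nat_const; apply: leq_sum => g _.
by rewrite card_itv_ord; lia.
Qed.

Local Open Scope ring_scope.

(** Expanding the product over subsets K of labels reduces this to
    [card_placements_hit] for each K. *)
Lemma config_product_moment (R : realFieldType) m (V : R)
    (c : {ffun 'I_m -> {set 'I_n}}) :
  0 <= V -> (m * ell <= n)%N -> c \in block_configs n m ell ->
  \sum_(b in block_configs n m ell)
     \prod_g (1 + V * (~~ [disjoint b g & \bigcup_h c h])%:R)
    <= #|block_configs n m ell|%:R *
         (1 + V * ((2 * (m * ell))%:R / (n - m * ell + 1)%:R)) ^+ m.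
Proof.
move=> V0 mn cc.
set a := (2 * (m * ell))%N; set D := (n - m * ell + 1)%N.
have D0 : (0 < D%:R :> R) by rewrite ltr0n /D addn1.
pose A := [set p : 'I_n.+1 |
  (p + ell <= n)%N && ~~ [disjoint block_at p & \bigcup_g c g]]%SET.
have cA : (#|A| <= a)%N by exact: card_hitting.
have cE : #|block_configs n m ell| = #|placements n ell n m|.
  by rewrite block_configsE card_in_imset//; exact: config_of_inj.
rewrite cE block_configsE big_imset/=; last exact: config_of_inj.
rewrite (eq_bigr (fun s : {ffun 'I_m -> 'I_n.+1} =>
    \sum_(K : {set 'I_m}) V ^+ #|K| * [forall g in K, s g \in A]%:R)); last first.
  move=> s /placementsP[sn _]; under eq_bigr do rewrite addrC.
  rewrite bigA_distr; apply: eq_big => [K|K _]; first by rewrite inE.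
  rewrite -big_mkcond/= big_split/= prodr_const; congr (_ * _).
  case: (boolP [forall g in K, _]) => [/forallP sK|/forallPn[g]].
    rewrite big1// => g gK; have := implyP (sK g) gK.
    by rewrite inE sn /= ffunE => ->.
  rewrite negb_imply => /andP[gK]; rewrite inE sn /= negbK => dis.
  by rewrite (bigD1 g)//= ffunE dis mul0r.
rewrite exchange_big/=.
have -> : (1 + V * (a%:R / D%:R)) ^+ m = \sum_(K : {set 'I_m}) (V * (a%:R / D%:R)) ^+ #|K|.
  transitivity (\prod_(g < m) (V * (a%:R / D%:R) + 1)).
    by rewrite prodr_const card_ord addrC.
  rewrite bigA_distr; apply: eq_big => [K|K _]; first by rewrite inE.
  by rewrite -big_mkcond/= prodr_const.
rewrite mulr_sumr; apply: ler_sum => K _.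
rewrite -mulr_sumr exprMn mulrCA ler_wpM2l ?exprn_ge0//.
rewrite expr_div_n -natrX -natrX mulrA ler_pdivlMr ?natrX ?exprn_gt0//.
rewrite -!natrX.
have -> : \sum_(s in placements n ell n m) [forall g in K, s g \in A]%:R =
    #|[set s in placements n ell n m | [forall g in K, s g \in A]]|%:R :> R.
  rewrite -sum1_card natr_sum [RHS]big_mkcond [LHS]big_mkcond /=.
  by apply: eq_bigr => s _; rewrite !inE; do 2 case: ifP => //; case: [forall g in K, _].
rewrite -!natrM ler_nat mulnC [leqRHS]mulnC.
exact: card_placements_hit.
Qed.

End Configs.

Local Open Scope classical_set_scope.
Local Open Scope ring_scope.

(** * Weighted laws and measures on tuples *)

Section density.
Context d (T : measurableType d) (R : realType) (P : {measure set T -> \bar R}).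
Variables (g : T -> R) (mg : measurable_fun setT g) (g0 : forall x, 0 <= g x).

Definition density_measure of measurable_fun setT g & (forall x, 0 <= g x) :
  set T -> \bar R := fun A => (\int[P]_(x in A) (g x)%:E)%E.

Local Notation nu := (density_measure mg g0).

Let nu0 : nu set0 = 0%E. Proof. by rewrite /density_measure integral_set0. Qed.

Let nu_ge0 A : (0 <= nu A)%E.
Proof. by apply: integral_ge0 => x _; rewrite lee_fin. Qed.

Let nu_sigma_additive : semi_sigma_additive nu.
Proof.
apply: semi_sigma_additive_nng_induced.
  by move/measurable_EFinP: mg.
by move=> x; rewrite lee_fin.
Qed.

HB.instance Definition _ := isMeasure.Build _ _ _ nu nu0 nu_ge0 nu_sigma_additive.

Import HBNNSimple.

Lemma ge0_integral_density_measure (f : T -> \bar R) :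
  measurable_fun setT f -> (forall x, 0 <= f x)%E ->
  (\int[nu]_x f x = \int[P]_x ((g x)%:E * f x))%E.
Proof.
move=> mf f0.
pose f_ := nnsfun_approx measurableT mf.
have cvf x : (f_ n x)%:E @[n --> \oo] --> f x by apply: cvg_nnsfun_approx.
have ndf x : {homo (fun n => f_ n x) : n m / (n <= m)%N >-> n <= m}.
  by move=> a b ab; exact/lefP/nd_nnsfun_approx.
transitivity (limn (fun n => \int[nu]_x (f_ n x)%:E)%E).
  rewrite -monotone_convergence//.
  - by apply: eq_integral => y _; apply/esym/cvg_lim.
  - by move=> n; exact/measurable_EFinP/measurable_funP.
  - by move=> n y _; rewrite lee_fin.
  - by move=> y _ a b ab; rewrite lee_fin ndf.
transitivity (limn (fun n => \int[P]_x ((g x)%:E * (f_ n x)%:E))%E); last first.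
  rewrite -monotone_convergence//.
  - apply: eq_integral => y _; apply/cvg_lim => //.
    by apply: cvgeZl => //; exact: cvf.
  - by move=> n; apply/measurable_EFinP/measurable_funM.
  - by move=> n y _; rewrite -EFinM lee_fin mulr_ge0.
  - by move=> y _ a b ab; rewrite -!EFinM lee_fin ler_wpM2l// ndf.
apply/congr_lim/funext => n.
have mpre k : measurable (f_ n @^-1` [set k]) by exact: measurable_sfunP.
under [LHS]eq_integral do rewrite fimfunE -fsumEFin//.
rewrite ge0_integral_fsum//; last 2 first.
- by move=> y; exact/measurable_EFinP/measurable_funM.
- by move=> y x _; rewrite nnfun_muleindic_ge0.
under [RHS]eq_integral do rewrite fimfunE -fsumEFin//.
transitivity (\int[P]_x \sum_(k \in range (f_ n))
    ((g x)%:E * (k * \1_(f_ n @^-1` [set k]) x)%:E))%E; last first.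
  apply: eq_integral => x _; rewrite ge0_mule_fsumr// => k.
  by rewrite nnfun_muleindic_ge0.
rewrite ge0_integral_fsum//; last 2 first.
- move=> k; apply: emeasurable_funM; first exact/measurable_EFinP.
  apply/measurable_EFinP.
  exact: measurable_funM.
- by move=> y x _; rewrite mule_ge0 ?lee_fin// -lee_fin nnfun_muleindic_ge0.
apply: eq_fsbigr => k /set_mem [x _ <-].
rewrite integralZl_indic_nnsfun// integral_indic//= setIT.
rewrite /density_measure [in LHS]integral_mkcond -ge0_integralZl//; last 3 first.
- apply/(measurable_restrictT _ (mpre _)).1; apply: measurable_funTS.
  exact/measurable_EFinP.
- by move=> y _; rewrite erestrict_ge0// => z _; rewrite lee_fin.
- by rewrite lee_fin.
apply: eq_integral => y _; rewrite patchE indicE.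
by case: ifPn => _; rewrite /= -?EFinM ?mulr1 ?mulr0 ?mule0// [in RHS]mulrC.
Qed.

End density.

(** If two random elements have the same law once reweighted by [g1] and [g2],
    they have the same reweighted expectations.  Independence ([g1] a function of
    the other coordinates, [g2] constant) and changes of measure ([g1] a
    density, [g2] equal to 1) are both used in this form. *)
Lemma eq_weighted_law d d1 d2 (U : measurableType d) (T1 : measurableType d1)
  (T2 : measurableType d2) (R : realType) (P1 : {measure set T1 -> \bar R})
  (P2 : {measure set T2 -> \bar R}) (g1 : T1 -> R) (g2 : T2 -> R)
  (X1 : T1 -> U) (X2 : T2 -> U) :
  measurable_fun setT g1 -> measurable_fun setT g2 ->
  (forall x, 0 <= g1 x) -> (forall x, 0 <= g2 x) ->
  measurable_fun setT X1 -> measurable_fun setT X2 ->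
  (forall A, measurable A -> \int[P1]_(x in X1 @^-1` A) (g1 x)%:E =
                             \int[P2]_(x in X2 @^-1` A) (g2 x)%:E)%E ->
  forall f : U -> \bar R, measurable_fun setT f -> (forall u, 0 <= f u)%E ->
  (\int[P1]_x ((g1 x)%:E * f (X1 x)) = \int[P2]_x ((g2 x)%:E * f (X2 x)))%E.
Proof.
move=> mg1 mg2 g10 g20 mX1 mX2 H f mf f0.
rewrite -(ge0_integral_density_measure P1 mg1 g10) //; last exact: measurableT_comp.
rewrite -(ge0_integral_density_measure P2 mg2 g20) //; last exact: measurableT_comp.
transitivity (\int[pushforward (density_measure P1 mg1 g10) X1]_u f u)%E.
  by rewrite ge0_integral_pushforward.
transitivity (\int[pushforward (density_measure P2 mg2 g20) X2]_u f u)%E; last first.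
  by rewrite ge0_integral_pushforward.
by apply: eq_measure_integral => A mA _; exact: H.
Qed.

Definition rectangle {R : realType} {n} (B : 'I_n -> set R) : set (n.-tuple R) :=
  [set x | forall i, B i (tnth x i)].

Lemma measurable_rectangle {R : realType} n (B : 'I_n -> set R) :
  (forall i, measurable (B i)) -> measurable (rectangle B).
Proof.
move=> mB.
rewrite [rectangle B](_ : _ =
  \bigcap_(i in [set: 'I_n]) ((@tnth n R)^~ i @^-1` B i)); last first.
  by apply/seteqP; split=> [x h i _|x h i]; [exact: h|exact: (h i I)].
apply: fin_bigcap_measurable => // i _.
by rewrite -[X in measurable X]setTI; exact: measurable_tnth.
Qed.

(** Rectangles form a pi-system that generates the sigma-algebra of tuples. *)
Lemma tuple_measure_unique {R : realType} n
    (m1 m2 : {measure set (n.-tuple R) -> \bar R}) :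
  (m1 setT < +oo)%E ->
  (forall B : 'I_n -> set R, (forall i, measurable (B i)) ->
     m1 (rectangle B) = m2 (rectangle B)) ->
  forall A, measurable A -> m1 A = m2 A.
Proof.
move=> fin1 H A mA.
pose G := [set rectangle B | B in [set B : 'I_n -> set R | forall i, measurable (B i)]].
have rT : rectangle (fun=> setT) = [set: n.-tuple R] by apply/seteqP; split.
apply: (measure_unique G (fun=> setT)) => //.
- apply/seteqP; split.
    apply: smallest_sub; first exact: smallest_sigma_algebra.
    case: n {m1 m2 fin1 H A mA rT} @G => [|n] G; first by rewrite big_ord0.
    rewrite -bigcup_mkord_ord; apply: bigcup_sub => i _ _ [B mB <-].
    apply: sub_sigma_algebra.
    exists (fun j => if j == inord i then B else setT) => /=.
      by move=> j; case: ifP.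
    rewrite setTI; apply/seteqP; split => x /=; first by move=> /(_ (inord i)); rewrite eqxx.
    by move=> Bx j; case: eqP => // ->.
  apply: smallest_sub; first exact: sigma_algebra_measurable.
  by move=> _ [B mB <-]; exact: measurable_rectangle.
- move=> _ _ [B mB <-] [C mC <-]; exists (fun i => B i `&` C i).
    by move=> i; exact: measurableI.
  apply/seteqP; split=> x /=; first by move=> h; split=> i; have [] := h i.
  by move=> [hB hC] i; split.
- by move=> _; exists (fun=> setT).
- by rewrite bigcup_const.
- by move=> _ [B mB <-]; exact: H.
Qed.

(** * The Gaussian change of measure *)

Section translation.
Context {R : realType}.
Local Notation leb := (@lebesgue_measure R).

Lemma lebesgue_measure_translation (v : R) (A : set R) : measurable A ->
  pushforward leb (fun x => v + x : measurableTypeR R) A = leb A.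
Proof.
have mt : measurable_fun setT (fun x : R => v + x : measurableTypeR R).
  exact: measurable_funD.
move=> mA; apply/esym/lebesgue_measure_unique => //= _ [[a b]] _ <-.
rewrite /pushforward.
rewrite (_ : (fun x => v + x) @^-1` `]a, b]%classic = `]a - v, b - v]%classic); last first.
  by apply/seteqP; split=> x /=; rewrite !in_itv/=; lra.
rewrite !lebesgue_measure_itv/= !lte_fin ltrD2r.
by case: ifP => // _; rewrite -!EFinB; congr (_%:E); ring.
Qed.

Lemma ge0_integral_translation (v : R) (f : R -> \bar R) :
  measurable_fun setT f -> (forall x, 0 <= f x)%E ->
  (\int[leb]_x f (v + x)%R = \int[leb]_x f x)%E.
Proof.
move=> mf f0.
have mt : measurable_fun setT (fun x => v + x : measurableTypeR R).
  exact: measurable_funD.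
transitivity (\int[pushforward leb (fun x => (v + x)%R : measurableTypeR R)]_x f x)%E.
  by rewrite ge0_integral_pushforward.
by apply: eq_measure_integral => A mA _; exact: lebesgue_measure_translation.
Qed.

Lemma normal_pdf_shift (v x : R) :
  normal_pdf 0 1 x * expR (v * x - v ^+ 2 / 2) = normal_pdf 0 1 (- v + x).
Proof.
rewrite normal_pdfE ?oner_eq0//= /normal_fun -mulrA -expRD; congr (_ * expR _).
by rewrite expr1n; field.
Qed.

End translation.

Section gaussian.
Context d (T : measurableType d) (R : realType) (P : probability T R).

Lemma integral_std_normal (X : {RV P >-> R}) :
  (forall B, measurable B -> distribution P X B = normal_prob 0 1 B) ->
  forall f : R -> \bar R, measurable_fun setT f -> (forall x, 0 <= f x)%E ->
  (\int[P]_w f (X w) = \int[lebesgue_measure]_x ((normal_pdf 0 1 x)%:E * f x))%E.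
Proof.
move=> nX f mf f0.
under eq_integral do rewrite -[f _]mul1e.
apply: (@eq_weighted_law _ _ _ _ _ _ _ P lebesgue_measure (cst 1)
  (normal_pdf 0 1) X id) => //.
- exact: measurable_normal_pdf.
- by move=> x; exact: normal_pdf_ge0.
- move=> A mA; rewrite [LHS](integral_cst P _ 1); last first.
    by rewrite -[X in measurable X]setTI; exact: measurable_funP.
  by rewrite mul1e; exact: nX.
Qed.

Lemma std_normal_shift (X : {RV P >-> R}) (v : R) :
  (forall B, measurable B -> distribution P X B = normal_prob 0 1 B) ->
  forall f : R -> \bar R, measurable_fun setT f -> (forall x, 0 <= f x)%E ->
  (\int[P]_w ((expR (v * X w - v ^+ 2 / 2))%:E * f (X w)) =
   \int[P]_w f (v + X w)%R)%E.
Proof.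
move=> nX f mf f0.
have me : measurable_fun setT (fun x : R => expR (v * x - v ^+ 2 / 2)).
  by apply: measurableT_comp => //; apply: measurable_funB => //; exact: measurable_funM.
rewrite (integral_std_normal nX
  (f := fun x => (expR (v * x - v ^+ 2 / 2))%:E * f x)%E); last 2 first.
- by apply: emeasurable_funM => //; exact/measurable_EFinP.
- by move=> x; rewrite mule_ge0// lee_fin expR_ge0.
have mfv : measurable_fun setT (fun x : R => f (v + x)%R).
  by apply: (@measurableT_comp _ _ _ _ _ _ f) => //; exact: measurable_funD.
rewrite (integral_std_normal nX (f := fun x => f (v + x)%R))//.
rewrite -(ge0_integral_translation (- v)
  (f := fun x => (normal_pdf 0 1 x)%:E * f (v + x)%R)%E); last 2 first.
- by apply: emeasurable_funM => //; apply/measurable_EFinP; exact: measurable_normal_pdf.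
- by move=> x; rewrite mule_ge0// lee_fin normal_pdf_ge0.
apply: eq_integral => x _.
by rewrite muleA -EFinM normal_pdf_shift addrA subrr add0r.
Qed.

(** Independence is given for events, that is, for indicators.  The functions
    [h i] are allowed to be general one index at a time: [K] is the set of
    indices for which this has been done, and for an index k in [K] both sides
    are weighted laws of [Z k] that agree on all sets by the case of K minus k. *)
Lemma independent_integral_prod n (Z : 'I_n -> {RV P >-> R}) :
  mutually_independent Z ->
  forall (K : {set 'I_n}) (h : 'I_n -> R -> R) (e : 'I_n -> R),
  (forall i, measurable_fun setT (h i)) -> (forall i x, 0 <= h i x) ->
  (forall i, i \notin K -> exists2 B, measurable B & h i = \1_B) ->
  (forall i, \int[P]_w (h i (Z i w))%:E = (e i)%:E)%E ->
  (\int[P]_w (\prod_i h i (Z i w))%:E = (\prod_i e i)%:E)%E.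
Proof.
move=> indZ K; have [k] := ubnP #|K|; elim: k => // k IH in K *.
move=> cK h e mh h0 hK he.
have mhZ i : measurable_fun setT (fun w => h i (Z i w)).
  by apply: (measurableT_comp (mh i)).
case: (set_0Vmem K) => [K0|[k0 k0K]].
  have {}hK i : exists B, measurable B /\ h i = \1_B.
    by have [|B mB hB] := hK i; [rewrite K0 inE|exists B].
  have /choice [B HB] : forall i, exists B, measurable B /\ h i = \1_B := hK.
  have eE i : (e i)%:E = P (Z i @^-1` B i).
    rewrite -he (HB i).2.
    have mB : measurable (Z i @^-1` B i).
      by rewrite -[X in measurable X]setTI; apply: measurable_funP => //; exact: (HB i).1.
    transitivity (\int[P]_w (\1_(Z i @^-1` B i) w)%:E)%E; first exact: eq_integral.
    by rewrite integral_indic// setIT.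
  have := indZ [set: 'I_n]%SET B (fun i => (HB i).1).
  rewrite (eq_bigr (fun i => (e i)%:E)) => [|i _]; last by rewrite eE.
  rewrite (eq_bigl xpredT) => [|i]; last by rewrite inE.
  rewrite -prodEFin => <-.
  set E := [set w | _].
  have mE : measurable E.
    rewrite [E](_ : _ = \bigcap_(i in [set: 'I_n]) (Z i @^-1` B i)).
      apply: fin_bigcap_measurable => // i _.
      by rewrite -[X in measurable X]setTI; apply: measurable_funP => //; exact: (HB i).1.
    by apply/seteqP; split=> [w h1 i _|w h1 i _]; [apply: h1; rewrite inE|exact: (h1 i I)].
  transitivity (\int[P]_w (\1_E w)%:E)%E; last by rewrite integral_indic// setIT.
  apply: eq_integral => w _; congr (_%:E).
  rewrite indicE; case: (boolP (w \in E)) => [/set_mem wE|/negP wE].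
    rewrite big1// => i _; rewrite (HB i).2 indicE mem_set//.
    by apply: wE; rewrite inE.
  have [i Bi] : exists i, ~ B i (Z i w).
    apply: contrapT => /forallNP H; apply: wE; apply/mem_set => i _.
    exact: contrapT (H i).
  by rewrite (bigD1 i)//= (HB i).2 indicE memNset// mul0r.
have H : forall A, measurable A ->
  (\int[P]_(w in Z k0 @^-1` A) (\prod_(i | i != k0) h i (Z i w))%:E =
   \int[P]_(w in Z k0 @^-1` A) (\prod_(i | i != k0) e i)%:E)%E.
  move=> A mA.
  have mZA : measurable (Z k0 @^-1` A).
    by rewrite -[X in measurable X]setTI; exact: measurable_funP.
  pose h' i := if i == k0 then \1_A else h i.
  pose e' i := if i == k0 then fine (P (Z k0 @^-1` A)) else e i.
  have := IH (K :\ k0)%SET _ h' e'.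
  rewrite integral_cst// [in X in _ -> X]integral_mkcond.
  have -> : (\prod_i e' i)%:E = ((\prod_(i | i != k0) e i)%:E * P (Z k0 @^-1` A))%E.
    rewrite (bigD1 k0)//= EFinM muleC; congr (_%:E * _)%E.
      by apply: eq_bigr => i /negbTE ik; rewrite /e' ik.
    by rewrite /e' eqxx fineK// fin_num_measure.
  move=> <-.
  - apply: eq_integral => w _; rewrite patchE [in RHS](bigD1 k0)//= /h' eqxx indicE.
    rewrite (_ : (w \in Z k0 @^-1` A) = (Z k0 w \in A)).
      case: ifP => _; rewrite ?mul0r// mul1r; congr (_%:E); apply: eq_bigr => i /negbTE ik.
      by rewrite ik.
    by apply/idP/idP => /set_mem ?; apply/mem_set.
  - by move: cK; rewrite (cardsD1 k0) k0K.
  - by move=> i; rewrite /h'; case: ifP.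
  - by move=> i x; rewrite /h'; case: ifP.
  - move=> i; rewrite !inE negb_and negbK /h'; case: eqVneq => [->|ik] /=; last exact: hK.
    by move=> _; exists A.
  - move=> i; rewrite /h' /e'; case: eqVneq => [->|ik] //.
    rewrite fineK ?fin_num_measure//.
    transitivity (\int[P]_w (\1_(Z k0 @^-1` A) w)%:E)%E; first exact: eq_integral.
    by rewrite integral_indic// setIT.
have e0 i : 0 <= e i.
  by rewrite -lee_fin -he integral_ge0// => w _; rewrite lee_fin.
have := @eq_weighted_law _ _ _ _ _ _ _ P P
  (fun w => \prod_(i | i != k0) h i (Z i w)) (cst (\prod_(i | i != k0) e i)) (Z k0) (Z k0).
move=> /(_ _ _ _ _ _ _ H (fun x => (h k0 x)%:E)) HH.
under eq_integral do rewrite (bigD1 k0)//= mulrC EFinM.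
rewrite HH//.
- rewrite /= ge0_integralZl//; last 3 first.
  + exact/measurable_EFinP.
  + by move=> w _; rewrite lee_fin.
  + by rewrite lee_fin prodr_ge0.
  by rewrite he -EFinM [in RHS](bigD1 k0)//= mulrC.
- by under eq_fun do rewrite -big_filter; exact: measurable_prod.
- by move=> w; rewrite prodr_ge0.
- by move=> w; rewrite prodr_ge0.
- exact/measurable_EFinP.
- by move=> u; rewrite lee_fin.
Qed.

End gaussian.

Section gaussian_vector.
Context d (T : measurableType d) (R : realType) (P : probability T R).
Variables (n : nat) (Z : 'I_n -> {RV P >-> R}).

Lemma measurable_shifted_noise (v : 'I_n -> R) :
  measurable_fun setT (fun w => [tuple v i + Z i w | i < n]).
Proof.
apply/measurable_fun_tnthP => i.
rewrite (_ : _ \o _ = fun w => v i + Z i w); first exact: measurable_funD.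
by apply/funext => w /=; rewrite tnth_mktuple.
Qed.

Lemma measurable_noise :
  measurable_fun setT (fun w => [tuple Z i w | i < n]).
Proof.
apply/measurable_fun_tnthP => i.
rewrite (_ : _ \o _ = Z i)//.
by apply/funext => w /=; rewrite tnth_mktuple.
Qed.

Hypothesis nZ : forall i B, measurable B -> distribution P (Z i) B = normal_prob 0 1 B.
Hypothesis indZ : mutually_independent Z.

(** The Cameron-Martin formula: shifting standard Gaussian noise by [v] amounts
    to reweighting it by its likelihood ratio.  Both sides are finite measures
    applied to [f]; they agree on rectangles by the one-dimensional formula and
    independence. *)
Lemma gaussian_shift (v : 'I_n -> R) (f : n.-tuple R -> \bar R) :
  measurable_fun setT f -> (forall x, 0 <= f x)%E ->
  (\int[P]_w ((expR (\sum_i (v i * Z i w - v i ^+ 2 / 2))%R)%:E *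
      f [tuple Z i w | i < n]) =
   \int[P]_w f [tuple (v i + Z i w)%R | i < n])%E.
Proof.
move=> mf f0.
have mS : measurable_fun setT (fun w => \sum_i (v i * Z i w - v i ^+ 2 / 2)).
  by apply: measurable_sum => i; apply: measurable_funB => //; exact: measurable_funM.
have mg : measurable_fun setT (fun w => expR (\sum_i (v i * Z i w - v i ^+ 2 / 2))).
  exact: measurableT_comp.
have mfv := measurable_shifted_noise v.
have mf0 := measurable_noise.
rewrite [RHS](_ : _ =
  \int[P]_w ((cst 1 w)%:E * f [tuple (v i + Z i w)%R | i < n]))%E; last first.
  by apply: eq_integral => w _; rewrite mul1e.
apply: eq_weighted_law => //.
have g0 w : 0 <= expR (\sum_i (v i * Z i w - v i ^+ 2 / 2)) by exact: expR_ge0.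
suff : forall A, measurable A ->
    pushforward (density_measure P mg g0) (fun w => [tuple Z i w | i < n]) A =
    pushforward P (fun w => [tuple v i + Z i w | i < n]) A.
  move=> H A mA; have := H _ mA; rewrite /pushforward /density_measure => ->.
  rewrite [RHS](integral_cst P _ 1); first by rewrite mul1e.
  by rewrite -[X in measurable X]setTI; exact: mfv.
have rect (B : 'I_n -> set R) : (forall i, measurable (B i)) ->
    pushforward (density_measure P mg g0) (fun w => [tuple Z i w | i < n]) (rectangle B) =
    pushforward P (fun w => [tuple v i + Z i w | i < n]) (rectangle B).
  move=> mB.
  pose h i x := expR (v i * x - v i ^+ 2 / 2) * \1_(B i) x.
  have mB' i : measurable ((fun x => v i + x) @^-1` B i).
    by rewrite -[X in measurable X]setTI; apply: measurable_funD.
  pose h' i : R -> R := \1_((fun x => v i + x) @^-1` B i).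
  pose e i := fine (P (Z i @^-1` ((fun x => v i + x) @^-1` B i))).
  have mZ i : measurable (Z i @^-1` ((fun x => v i + x) @^-1` B i)).
    by rewrite -[X in measurable X]setTI; exact: measurable_funP.
  have eP i : (\int[P]_w (h' i (Z i w))%:E = (e i)%:E)%E.
    rewrite fineK ?fin_num_measure//.
    transitivity (\int[P]_w (\1_(Z i @^-1` ((fun x => v i + x) @^-1` B i)) w)%:E)%E.
      exact: eq_integral.
    by rewrite integral_indic// setIT.
  have mR1 : measurable ((fun w => [tuple Z i w | i < n]) @^-1` rectangle B).
    by rewrite -[X in measurable X]setTI; apply: mf0 => //; exact: measurable_rectangle.
  have mR2 : measurable ((fun w => [tuple v i + Z i w | i < n]) @^-1` rectangle B).
    by rewrite -[X in measurable X]setTI; apply: mfv => //; exact: measurable_rectangle.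
  have prodE (X : 'I_n -> R) (C : 'I_n -> set R) :
      \prod_i (\1_(C i) (X i) : R) = (\1_[set x | forall i, C i (x i)] : _ -> R) X.
    rewrite indicE; case: (boolP (X \in _)) => [/set_mem H|/negP H].
      by rewrite big1// => i _; rewrite indicE mem_set.
    have [i Ci] : exists i, ~ C i (X i).
      apply: contrapT => /forallNP H'; apply: H; apply/mem_set => i.
      exact: contrapT (H' i).
    by rewrite (bigD1 i)//= indicE memNset// mul0r.
  transitivity (\prod_i e i)%:E.
    rewrite -(@independent_integral_prod _ _ _ _ _ _ indZ [set: 'I_n]%SET h e).
    - rewrite /pushforward /density_measure integral_mkcond; apply: eq_integral => w _.
      rewrite /h big_split/= -expR_sum prodE patchE indicE.
      rewrite (_ : (w \in _) =
          ((fun i => Z i w) \in [set x : 'I_n -> R | forall i, B i (x i)])).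
        by case: ifP => _; rewrite ?mulr1 ?mulr0.
      by apply/idP/idP => /set_mem /= H; apply/mem_set => i; have := H i; rewrite tnth_mktuple.
    - move=> i; apply: measurable_funM => //.
      by apply: measurableT_comp => //; apply: measurable_funB => //; exact: measurable_funM.
    - by move=> i x; rewrite mulr_ge0// expR_ge0.
    - by move=> i; rewrite inE.
    - move=> i; rewrite -eP.
      rewrite -(std_normal_shift (v i) (nZ i) (f := fun x => (\1_(B i) x)%:E))//.
      exact/measurable_EFinP.
  rewrite -(@independent_integral_prod _ _ _ _ _ _ indZ finset.set0 h' e)//.
  - transitivity (\int[P]_w
      (\1_((fun w => [tuple v i + Z i w | i < n]) @^-1` rectangle B) w)%:E)%E; last first.
      by rewrite integral_indic// setIT.
    apply: eq_integral => w _; rewrite prodE !indicE; congr ((nat_of_bool _)%:R%:E).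
    by apply/idP/idP => /set_mem /= H; apply/mem_set => i; have := H i; rewrite tnth_mktuple.
  - by move=> i; apply: measurable_indic.
  - by move=> i _; exists ((fun x => v i + x) @^-1` B i).
apply: tuple_measure_unique => //.
have := rect (fun=> setT) (fun=> measurableT).
rewrite (_ : rectangle _ = setT); last by apply/seteqP; split.
rewrite {2}/pushforward preimage_setT probability_setT => E.
by apply: (@le_lt_trans _ _ 1%E); [rewrite -E|exact: ltry].
Qed.

Definition exp_linear (c : 'I_n -> R) (k : R) (w : T) : R :=
  expR (\sum_i c i * Z i w - k).

Lemma measurable_exp_linear c k : measurable_fun setT (exp_linear c k).
Proof.
apply: measurableT_comp => //; apply: measurable_funB => //.
by apply: measurable_sum => i; exact: measurable_funM.
Qed.

Lemma integral_exp_linear c k :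
  P.-integrable setT (EFin \o exp_linear c k) /\
  \int[P]_w exp_linear c k w = expR (\sum_i c i ^+ 2 / 2 - k).
Proof.
set K := \sum_i c i ^+ 2 / 2.
have E w : exp_linear c k w =
    expR (K - k) * expR (\sum_i (c i * Z i w - c i ^+ 2 / 2)).
  by rewrite /exp_linear -expRD sumrB -/K; congr expR; ring.
have H := @gaussian_shift c (cst 1%E) (measurable_cst _) (fun=> lee01).
rewrite [in RHS](integral_cst P measurableT 1) [in RHS]mul1e in H.
rewrite [X in _ = X]probability_setT in H.
have mS : measurable_fun setT
    (fun w => expR (\sum_i (c i * Z i w - c i ^+ 2 / 2))).
  apply: measurableT_comp => //; apply: measurable_sum => i.
  by apply: measurable_funB => //; exact: measurable_funM.
have ei : (\int[P]_w (exp_linear c k w)%:E = (expR (K - k))%:E)%E.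
  under eq_integral do rewrite E EFinM.
  rewrite ge0_integralZl//; last exact/measurable_EFinP.
  rewrite -[RHS]mule1 -[X in _ = (_ * X)%E]H; congr (_ * _)%E.
  by apply: eq_integral => w _; rewrite mule1.
split; last by rewrite /Rintegral ei.
apply/integrableP; split.
  by apply/measurable_EFinP; exact: measurable_exp_linear.
rewrite (eq_integral (fun w => (exp_linear c k w)%:E)) ?ei ?ltry// => w _ /=.
by rewrite ger0_norm// expR_ge0.
Qed.

End gaussian_vector.

(** * Conditioning on the configuration *)

Section model.
Context d (T : measurableType d) (R : realType) (P : probability T R).
Variables (n m ell : nat) (Z : 'I_n -> {RV P >-> R}) (I : T -> {ffun 'I_m -> {set 'I_n}}).
Hypothesis model : multiple_blocks_model ell Z I.

Definition support (c : {ffun 'I_m -> {set 'I_n}}) : {set 'I_n} :=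
  (\bigcup_(g < m) c g)%SET.

(** Under the model the observation is a mixture, over the equally likely
    configurations, of noise shifted by a deterministic signal. *)
Lemma integral_observation (mu : R) (f : n.-tuple R -> R) :
  measurable_fun setT f -> (forall x, 0 <= f x) ->
  (\int[P]_w (f (observation Z I mu w))%:E =
   \sum_(c in block_configs n m ell) (#|block_configs n m ell|%:R^-1)%:E *
     \int[P]_w (f [tuple (mu * (i \in support c)%:R + Z i w)%R | i < n])%:E)%E.
Proof.
move=> mf f0.
pose fc c w := f [tuple mu * (i \in support c)%:R + Z i w | i < n].
have mfc c : measurable_fun setT (fc c).
  by apply: (measurableT_comp mf); exact: measurable_shifted_noise.
have mI c : measurable (I @^-1` [set c]) by exact: blocks_measurable model _.
transitivity (\int[P]_w \sum_c ((\1_(I @^-1` [set c]) w)%:E * (fc c w)%:E))%E.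
  apply: eq_integral => w _; rewrite (bigD1 (I w))//= big1 ?adde0.
    by rewrite indicE mem_set// mul1e.
  move=> c cI; rewrite indicE memNset ?mul0e// => /= E; move: cI.
  by rewrite E eqxx.
rewrite ge0_integral_sum//; last 2 first.
- by move=> c; apply: emeasurable_funM; exact/measurable_EFinP.
- by move=> c w _; rewrite mule_ge0 ?lee_fin// f0.
rewrite [RHS]big_mkcond/=; apply: eq_bigr => c _.
have PI := blocks_uniform model c.
pose q : R := fine (P (I @^-1` [set c])).
have qE : P (I @^-1` [set c]) = q%:E by rewrite fineK// fin_num_measure.
have q0 : 0 <= q by rewrite -lee_fin -qE.
transitivity (\int[P]_w (q%:E * (fc c w)%:E))%E; last first.
  rewrite ge0_integralZl//; last 2 first.
  - exact/measurable_EFinP.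
  - by move=> w _; rewrite lee_fin f0.
  by rewrite -qE PI; case: ifP => // _; rewrite mul0e.
pose F (x : n.-tuple R) := (f [tuple mu * (i \in support c)%:R + tnth x i | i < n])%:E.
have FE w : F [tuple Z i w | i < n] = (fc c w)%:E.
  rewrite /F /fc; congr (f _)%:E; apply: eq_mktuple => i.
  by rewrite tnth_mktuple.
under eq_integral do rewrite -FE.
under [RHS]eq_integral do rewrite -FE.
have mz := measurable_noise Z.
apply: (@eq_weighted_law _ _ _ _ _ _ _ P P (\1_(I @^-1` [set c])) (cst q)
  (fun w => [tuple Z i w | i < n]) (fun w => [tuple Z i w | i < n])) => //.
- move=> A mA.
  have mZA : measurable [set w | A [tuple Z i w | i < n]].
    by rewrite -[X in measurable X]setTI; exact: mz.
  rewrite integral_indic// [RHS](integral_cst P _ q%:E)// -qE.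
  exact: (blocks_independent_noise model c mA).
- apply/measurable_EFinP; apply: (measurableT_comp mf).
  apply/measurable_fun_tnthP => i.
  rewrite (_ : _ \o _ = fun x => mu * (i \in support c)%:R + tnth x i).
    by apply: measurable_funD => //; exact: measurable_tnth.
  by apply/funext => x /=; rewrite tnth_mktuple.
- by move=> x; rewrite lee_fin.
Qed.

(** Otherwise the values that [blocks_uniform] prescribes would sum to 0. *)
Lemma block_configs_gt0 : (0 < #|block_configs n m ell|)%N.
Proof.
rewrite lt0n; apply/negP => /eqP/card0_eq c0.
have := integral_observation 0 (f := cst 1) (measurable_cst _) (fun=> ler01).
rewrite big_pred0// => H.
have : (1 = 0 :> \bar R)%E.
  rewrite -{}H /= (integral_cst P measurableT 1%E) mul1e.
  by rewrite -(@probability_setT _ _ _ P).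
by move/eqP; rewrite onee_eq0.
Qed.

End model.

(** * The truncated second moment method *)

Section l2.
Context d (T : measurableType d) (R : realType) (P : probability T R).

Lemma Rintegral_sum (J : Type) (s : seq J) (p : pred J) (f : J -> T -> R) :
  (forall j, p j -> P.-integrable setT (EFin \o f j)) ->
  P.-integrable setT (EFin \o (fun w => \sum_(j <- s | p j) f j w)) /\
  \int[P]_w (\sum_(j <- s | p j) f j w) = \sum_(j <- s | p j) \int[P]_w f j w.
Proof.
move=> fi; elim: s => [|j s [IH1 IH2]].
  have -> : (fun w => \sum_(j <- [::] | p j) f j w) = cst 0.
    by apply/funext => w; rewrite big_nil.
  by rewrite big_nil; split; [exact: integrable0|rewrite Rintegral_cst// mul0r].
rewrite big_cons; case: ifP => pj; last first.
  have -> : (fun w => \sum_(j <- j :: s | p j) f j w) = (fun w => \sum_(j <- s | p j) f j w).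
    by apply/funext => w; rewrite big_cons pj.
  by [].
have -> : (fun w => \sum_(j <- j :: s | p j) f j w) =
    f j \+ (fun w => \sum_(j <- s | p j) f j w).
  by apply/funext => w; rewrite big_cons pj.
split; first by have := integrableD measurableT (fi _ pj) IH1.
by rewrite -IH2 RintegralD//; exact: fi.
Qed.

Lemma dominated_integrable (f g : T -> R) : measurable_fun setT f ->
  (forall w, 0 <= f w <= g w) -> P.-integrable setT (EFin \o g) ->
  P.-integrable setT (EFin \o f).
Proof.
move=> mf fg ig; apply: le_integrable ig => //; first exact/measurable_EFinP.
move=> w _ /=; have /andP[f0 fgw] := fg w.
by rewrite lee_fin !ger0_norm// (le_trans f0).
Qed.

(** Here [p] is the value of the test, [l] that of the likelihood ratio and [g]
    that of the truncated one.  The deviation |1 - g| is replaced by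
    del + (1 - g)^2 / del, whose expectation involves the first two moments of
    [g] only; terms are moved so that both sides are sums of integrable
    nonnegative functions. *)
Lemma test_deviation (del p g l : R) : 0 < del -> 0 <= p <= 1 -> 0 <= g <= l ->
  p + (2 / del) * g <= p * l + (del^-1 * g ^+ 2 + (del + del^-1)) /\
  p * l + (1 + 2 / del) * g <= p + (l + (del^-1 * g ^+ 2 + (del + del^-1))).
Proof.
move=> del0 /andP[p0 p1] /andP[g0 gl].
have amgm : `|1 - g| <= del + del^-1 * (1 - 2 * g + g ^+ 2).
  rewrite (_ : 1 - 2 * g + g ^+ 2 = `|1 - g| ^+ 2); last first.
    by rewrite real_normK ?num_real//; ring.
  rewrite -(ler_pM2l del0) mulrDr mulVKf ?gt_eqF//.
  by have := sqr_ge0 (`|1 - g| - del / 2); have := sqr_ge0 del; lra.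
have h1 : p * (1 - l) <= `|1 - g|.
  apply: (@le_trans _ _ (p * `|1 - g|)); last by rewrite ler_piMl.
  by rewrite ler_wpM2l// (le_trans _ (ler_norm _))//; lra.
have h2 : p * (l - g) <= l - g by rewrite ler_piMl//; lra.
have h3 : p * (g - 1) <= `|1 - g|.
  apply: (@le_trans _ _ (p * `|1 - g|)); last by rewrite ler_piMl.
  by rewrite ler_wpM2l// distrC ler_norm.
by split; lra.
Qed.

(** The average truncated likelihood ratio G has mean at least 1 - eps and second
    moment at most B, hence E (1 - G)^2 <= B - 1 + 2 eps, and G differs from the
    full average by at most eps in mean.  Optimizing over the free parameter
    [del] would give the Cauchy-Schwarz bound. *)
Lemma truncated_second_moment_bound (J : finType) (D : {set J})
    (L wt : J -> T -> R) (phi : T -> R) (eps B del : R) :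
  (0 < #|D|)%N -> 0 < del ->
  measurable_fun setT phi -> (forall w, 0 <= phi w <= 1) ->
  (forall c, measurable_fun setT (L c)) -> (forall c w, 0 <= L c w) ->
  (forall c, measurable_fun setT (wt c)) -> (forall c w, 0 <= wt c w <= 1) ->
  (forall c, c \in D -> P.-integrable setT (EFin \o L c)) ->
  (forall c, c \in D -> \int[P]_w L c w = 1) ->
  (forall c, c \in D -> \int[P]_w (L c w * (1 - wt c w)) <= eps) ->
  (forall c c', c \in D -> c' \in D ->
     P.-integrable setT (EFin \o (fun w => (L c w * wt c w) * (L c' w * wt c' w)))) ->
  \sum_(c in D) \sum_(c' in D) \int[P]_w ((L c w * wt c w) * (L c' w * wt c' w))
     <= B * #|D|%:R ^+ 2 ->
  `|\int[P]_w phi w - #|D|%:R^-1 * \sum_(c in D) \int[P]_w (phi w * L c w)|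
    <= eps + del + (B - 1 + 2 * eps) / del.
Proof.
move=> D0 del0 mphi phi01 mL L0 mw w01 iL EL Ew iLL EB.
set q : R := #|D|%:R^-1.
have q0 : 0 < q by rewrite invr_gt0 ltr0n.
have qD : q * #|D|%:R = 1 by rewrite mulVf// pnatr_eq0 -lt0n.
pose phiL w := q * \sum_(c in D) (phi w * L c w).
pose LL w := q * \sum_(c in D) L c w.
pose G w := q * \sum_(c in D) (L c w * wt c w).
pose GG w := q ^+ 2 * \sum_(c in D) \sum_(c' in D) ((L c w * wt c w) * (L c' w * wt c' w)).
have iphi : P.-integrable setT (EFin \o phi).
  apply: (@dominated_integrable _ (cst 1)) => //.
  by apply: finite_measure_integrable_cst.
have iphiL c : c \in D -> P.-integrable setT (EFin \o (fun w => phi w * L c w)).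
  move=> cD; apply: (dominated_integrable _ _ (iL c cD)); first exact: measurable_funM.
  move=> w; have /andP[p0 p1] := phi01 w.
  by rewrite mulr_ge0//= ler_piMl.
have iLw c : c \in D -> P.-integrable setT (EFin \o (fun w => L c w * wt c w)).
  move=> cD; apply: (dominated_integrable _ _ (iL c cD)); first exact: measurable_funM.
  move=> w; have /andP[p0 p1] := w01 c w.
  by rewrite mulr_ge0//= ler_piMr.
have iZ (k : R) f : P.-integrable setT (EFin \o f) ->
    P.-integrable setT (EFin \o (fun w => k * f w)) /\
    \int[P]_w (k * f w) = k * \int[P]_w f w.
  move=> fi; split; last by rewrite RintegralZl.
  by have := integrableZl measurableT k fi.
have iA f g : P.-integrable setT (EFin \o f) -> P.-integrable setT (EFin \o g) ->
    P.-integrable setT (EFin \o (fun w => f w + g w)) /\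
    \int[P]_w (f w + g w) = \int[P]_w f w + \int[P]_w g w.
  move=> fi gi; split; last by rewrite RintegralD.
  by have := integrableD measurableT fi gi.
have iC (k : R) : P.-integrable setT (EFin \o (fun=> k)) /\ \int[P]_w k = k.
  split; first exact: finite_measure_integrable_cst.
  by rewrite Rintegral_cst// (_ : fine _ = 1) ?mulr1// -[X in fine X]/(P setT) probability_setT.
have [iphiLs EphiLs] := Rintegral_sum (index_enum J) iphiL.
have [{}iphiLs {}EphiLs'] := iZ q _ iphiLs.
have [iLs ELs] := Rintegral_sum (index_enum J) iL.
have [{}iLs ELs'] := iZ q _ iLs.
have [iLws ELws] := Rintegral_sum (index_enum J) iLw.
have [{}iLws ELws'] := iZ q _ iLws.
have iGG1 c (cD : c \in D) :=
  Rintegral_sum (index_enum J) (fun c' (c'D : c' \in D) => iLL c c' cD c'D).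
have [iGGs EGGs] :=
  Rintegral_sum (index_enum J) (fun c (cD : c \in D) => (iGG1 c cD).1).
have [{}iGGs EGGs'] := iZ (q ^+ 2) _ iGGs.
have ELL1 : \int[P]_w LL w = 1.
  by rewrite /LL ELs' ELs (eq_bigr (fun=> 1)) ?sumr_const// => c cD; exact: EL.
have EG : 1 - eps <= \int[P]_w G w.
  rewrite /G ELws' ELws -[leLHS]mul1r -qD -mulrA ler_pM2l//.
  rewrite mulr_natl -sumr_const; apply: ler_sum => c cD.
  have := Ew c cD.
  rewrite (_ : (\int[P]_w (L c w * (1 - wt c w))) =
      1 - \int[P]_w (L c w * wt c w)); first lra.
  rewrite -[X in _ = X - _](EL c cD) -RintegralB//; [|exact: iL|exact: iLw].
  by apply: eq_Rintegral => w _; rewrite mulrBr mulr1.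
have EGG : \int[P]_w GG w <= B.
  rewrite /GG EGGs' EGGs.
  rewrite (eq_bigr (fun c =>
    \sum_(c' in D) \int[P]_w ((L c w * wt c w) * (L c' w * wt c' w)))).
    rewrite -[leRHS]mulr1 -(expr1n _ 2) -qD exprMn mulrCA ler_pM2l ?exprn_gt0//.
  by move=> c cD; exact: (iGG1 c cD).2.
have GGE w : GG w = G w ^+ 2.
  rewrite /GG /G exprMn; congr (_ * _); rewrite expr2 mulr_suml.
  by apply: eq_bigr => c _; rewrite mulr_sumr.
have G0 w : 0 <= G w <= LL w.
  apply/andP; split.
    rewrite mulr_ge0 ?(ltW q0)// sumr_ge0// => c _; rewrite mulr_ge0//.
    by have /andP[] := w01 c w.
  rewrite ler_pM2l//; apply: ler_sum => c _; rewrite ler_piMr//.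
  by have /andP[] := w01 c w.
have phiLE w : phiL w = phi w * LL w.
  by rewrite /phiL /LL [RHS]mulrCA; congr (_ * _); rewrite mulr_sumr.
have up w : phi w + (2 / del) * G w <= phiL w + (del^-1 * GG w + (del + del^-1)).
  by rewrite phiLE GGE; exact: (test_deviation del0 (phi01 w) (G0 w)).1.
have lo w : phiL w + (1 + 2 / del) * G w <=
    phi w + (LL w + (del^-1 * GG w + (del + del^-1))).
  by rewrite phiLE GGE; exact: (test_deviation del0 (phi01 w) (G0 w)).2.
have [iC1 EC1] := iC (del + del^-1).
have [iGGd EGGd] := iZ del^-1 _ iGGs.
have [i1 E1] := iA _ _ iGGd iC1.
have [i2 E2] := iA _ _ iphiLs i1.
have [i3 E3] := iA _ _ iLs i1.
have [i4 E4] := iA _ _ iphi i3.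
have [i5 E5] := iZ (2 / del) _ iLws.
have [i6 E6] := iA _ _ iphi i5.
have [i7 E7] := iZ (1 + 2 / del) _ iLws.
have [i8 E8] := iA _ _ iphiLs i7.
have Up := le_Rintegral measurableT i6 i2 (fun w _ => up w).
have Lo := le_Rintegral measurableT i8 i4 (fun w _ => lo w).
rewrite E6 E5 E2 E1 EGGd EC1 in Up.
rewrite E8 E7 E4 E3 E1 EGGd EC1 in Lo.
rewrite -EphiLs -EphiLs'.
move: Up Lo EG EGG ELL1; rewrite /GG /G /LL.
set a := \int[P]_w phi w; set g := \int[P]_w (q * _); set b := \int[P]_w (q * _).
set gg := \int[P]_w (q ^+ 2 * _); set l := \int[P]_w (q * _).
move=> Up Lo EG EGG l1.
have GL w : setT w -> G w <= LL w by move=> _; have /andP[] := G0 w.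
have gl : g <= l := le_Rintegral measurableT iLws iLs GL.
have di0 : 0 < del^-1 by rewrite invr_gt0.
have h1 : del^-1 * gg <= del^-1 * B by rewrite ler_pM2l.
have h2 : del^-1 * (1 - eps) <= del^-1 * g by rewrite ler_pM2l.
move: Up Lo gl l1 EG EGG h1 h2 di0; clear; move: del^-1 => D1.
by move=> *; rewrite ler_norml; apply/andP; split; lra.
Qed.

End l2.

(** * The error bound for a fixed sample size *)

Section finite_bound.
Context d (T : measurableType d) (R : realType) (P : probability T R).
Variables (n m ell : nat) (Z : 'I_n -> {RV P >-> R}) (I : T -> {ffun 'I_m -> {set 'I_n}}).
Hypothesis model : multiple_blocks_model ell Z I.
Hypothesis ell0 : (0 < ell)%N.
Hypothesis fit : (m * ell <= n)%N.

Let nZ := noise_std_normal model.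
Let indZ := noise_independent model.
Local Notation D := (block_configs n m ell).

Local Notation exp_linear := (exp_linear Z).

Definition block_sum (b : {set 'I_n}) (w : T) : R := \sum_(i in b) Z i w.

Definition mean_of (mu : R) (c : {ffun 'I_m -> {set 'I_n}}) (i : 'I_n) : R :=
  mu * (i \in support c)%:R.

Definition block_lr (mu : R) c : T -> R :=
  exp_linear (mean_of mu c) (\sum_i mean_of mu c i ^+ 2 / 2).

Definition trunc (tau : R) (c : {ffun 'I_m -> {set 'I_n}}) (w : T) : R :=
  \prod_g \1_[set y : R | y <= tau] (block_sum (c g) w).

Lemma trunc01 tau c w : 0 <= trunc tau c w <= 1.
Proof.
apply/andP; split; first by rewrite prodr_ge0.
by apply: prodr_ile1 => g _; rewrite indicE; case: (_ \in _); rewrite ?ler01 ?lexx.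
Qed.

Lemma measurable_trunc tau c : measurable_fun setT (trunc tau c).
Proof.
apply: measurable_prod => g _; apply: measurableT_comp.
  apply: measurable_indic; rewrite [X in measurable X](_ : _ = `]-oo, tau]%classic)//.
rewrite /block_sum; under eq_fun do rewrite big_mkcond/=.
by apply: measurable_sum => i; case: (i \in c g).
Qed.

Lemma measurable_block_lr mu c : measurable_fun setT (block_lr mu c).
Proof. exact: measurable_exp_linear. Qed.

Lemma block_lr_ge0 mu c w : 0 <= block_lr mu c w.
Proof. exact: expR_ge0. Qed.

Lemma integral_block_lr mu c :
  P.-integrable setT (EFin \o block_lr mu c) /\ \int[P]_w block_lr mu c w = 1.
Proof.
have [h1 h2] := integral_exp_linear nZ indZ (mean_of mu c) (\sum_i mean_of mu c i ^+ 2 / 2).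
by split; rewrite // h2 subrr expR0.
Qed.

Lemma config_card c g : c \in D -> #|c g| = ell.
Proof. by rewrite inE => /andP[/forallP/(_ g)/andP[_ /eqP]]. Qed.

Lemma config_disjoint c g h i : c \in D -> i \in c g -> i \in c h -> g = h.
Proof.
rewrite inE => /andP[_ /forallP/(_ g)/forallP/(_ h)/implyP dis] ig ih.
by apply/eqP; apply: contraT => /dis /disjointFr /(_ ig); rewrite ih.
Qed.

Lemma mem_support (c : {ffun 'I_m -> {set 'I_n}}) g i : i \in c g -> i \in support c.
Proof. by move=> ig; apply/bigcupP; exists g. Qed.

Lemma sum_support c (F : 'I_n -> 'I_m -> R) (G : 'I_n -> R) : c \in D ->
  (forall i, i \notin support c -> G i = 0) ->
  (forall i g, i \in c g -> G i = F i g) ->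
  \sum_i G i = \sum_g \sum_(i in c g) F i g.
Proof.
move=> cD G0 GF.
rewrite (exchange_big_dep xpredT)//=; apply: eq_bigr => i _.
case: (boolP (i \in support c)) => [/bigcupP[g _ ig]|ic].
  rewrite (bigD1 g)//= big1 ?addr0 ?(GF _ _ ig)// => h /andP[ih hg].
  by case/eqP: hg; exact: config_disjoint ih ig.
by rewrite G0// big_pred0// => g; apply/negbTE; apply: contra ic; exact: mem_support.
Qed.

(** Union bound over the blocks.  Under the likelihood ratio of [c] each block
    sum is normal with mean [mu * ell] and variance [ell]; Chernoff's bound with
    the optimal exponent [th] gives the stated tail. *)
Lemma truncation_loss mu tau c : c \in D -> mu * ell%:R <= tau ->
  \int[P]_w (block_lr mu c w * (1 - trunc tau c w)) <=
    m%:R * expR (- (tau - mu * ell%:R) ^+ 2 / (2 * ell%:R)).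
Proof.
move=> cD tau0.
have l0 : 0 < ell%:R :> R by rewrite ltr0n.
pose th := (tau - mu * ell%:R) / ell%:R.
have th0 : 0 <= th by rewrite divr_ge0 ?subr_ge0// ltW.
pose a g i := mean_of mu c i + th * (i \in c g)%:R.
pose k := \sum_i mean_of mu c i ^+ 2 / 2 + th * tau.
have bsE g w : \sum_i (i \in c g)%:R * Z i w = block_sum (c g) w.
  rewrite /block_sum [RHS]big_mkcond/=; apply: eq_bigr => i _.
  by case: (i \in c g); rewrite ?mul1r ?mul0r.
have eE g w : block_lr mu c w * expR (th * (block_sum (c g) w - tau)) = exp_linear (a g) k w.
  rewrite /block_lr /exp_linear -expRD -bsE; congr expR; rewrite mulrBr mulr_sumr /k /a.
  under [in RHS]eq_bigr do rewrite mulrDl -(mulrA th).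
  by rewrite big_split/=; ring.
have iE g := integral_exp_linear nZ indZ (a g) k.
have ie g : P.-integrable setT (EFin \o exp_linear (a g) k) by have [] := iE g.
have [iS ES] := Rintegral_sum (index_enum 'I_m) (fun g (_ : true) => ie g).
have [iL EL] := integral_block_lr mu c.
have t01 := trunc01 tau c.
have mt := @measurable_trunc tau c.
have pw w : 0 <= block_lr mu c w * (1 - trunc tau c w) <= \sum_g exp_linear (a g) k w.
  have /andP[t0 t1] := t01 w.
  rewrite mulr_ge0 ?block_lr_ge0 ?subr_ge0//=.
  under eq_bigr do rewrite -eE.
  rewrite -mulr_sumr ler_wpM2l ?block_lr_ge0//.
  case: (boolP [forall g, block_sum (c g) w <= tau]) => [/forallP H|/forallPn[g]].
    rewrite [trunc _ _ _]big1; last by move=> g _; rewrite indicE mem_set//=; exact: H.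
    by rewrite subrr sumr_ge0// => g _; rewrite expR_ge0.
  rewrite -ltNge => H; rewrite (bigD1 g)//=.
  apply: (@le_trans _ _ 1); first lra.
  apply: ler_wpDr; first by rewrite sumr_ge0// => h _; rewrite expR_ge0.
  by rewrite -expR0 ler_expR mulr_ge0// subr_ge0 ltW.
have il : P.-integrable setT (EFin \o (fun w => block_lr mu c w * (1 - trunc tau c w))).
  apply: dominated_integrable pw iS.
  by apply: measurable_funM; [exact: measurable_block_lr|exact: measurable_funB].
apply: (le_trans (le_Rintegral measurableT il iS (fun w _ => (andP (pw w)).2))).
rewrite ES mulr_natl -[X in _ *+ X](card_ord m) -sumr_const; apply: ler_sum => g _.
rewrite (iE g).2 ler_expR.
have -> : \sum_i a g i ^+ 2 / 2 =
    \sum_i mean_of mu c i ^+ 2 / 2 + \sum_(i in c g) (th * mu + th ^+ 2 / 2).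
  rewrite [X in _ = _ + X]big_mkcond -big_split/=; apply: eq_bigr => i _.
  rewrite /a /mean_of; case: (boolP (i \in c g)) => ig; last by rewrite mulr0 addr0; lra.
  by rewrite (mem_support ig) /=; field.
rewrite sumr_const (config_card g cD) /k /th -mulr_natr le_eqVlt; apply/orP; left; apply/eqP.
by field; rewrite gt_eqF.
Qed.

Definition hits (b : {set 'I_n}) (c : {ffun 'I_m -> {set 'I_n}}) : bool :=
  ~~ [disjoint b & support c].

(** The indicator that all block sums are at most [tau] is at most the product of
    exp (lg g (tau - block sum)) for any nonnegative [lg]; the exponent is [lam]
    for the blocks that meet [c'] and 0 for the others, so that the latter
    contribute exactly 1.  For a block that meets [c'] the exponent obtained is
    affine in the overlap with slope mu (mu - lam) >= 0, and the left-hand side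
    of the hypothesis on [V] is its value at complete overlap. *)
Lemma second_moment_pair mu lam tau V c c' : c \in D ->
  0 <= lam <= mu -> 0 <= V ->
  expR (mu ^+ 2 * ell%:R - lam * (2 * mu * ell%:R - tau) + lam ^+ 2 * ell%:R / 2) <= 1 + V ->
  P.-integrable setT (EFin \o (fun w => (block_lr mu c w * trunc tau c w) *
     (block_lr mu c' w * trunc tau c' w))) /\
  \int[P]_w ((block_lr mu c w * trunc tau c w) * (block_lr mu c' w * trunc tau c' w)) <=
    \prod_g (1 + V * (hits (c g) c')%:R).
Proof.
move=> cD /andP[lam0 lammu] V0 hV.
pose lg g : R := lam * (hits (c g) c')%:R.
have lg0 g : 0 <= lg g by rewrite mulr_ge0.
pose Lam i := \sum_(g | i \in c g) lg g.
pose v := mean_of mu c; pose v' := mean_of mu c'.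
pose a i := v i + v' i - Lam i.
pose k := \sum_i v i ^+ 2 / 2 + \sum_i v' i ^+ 2 / 2 - tau * \sum_g lg g.
have eE w : block_lr mu c w * block_lr mu c' w *
    expR (- \sum_g lg g * (block_sum (c g) w - tau)) = exp_linear a k w.
  rewrite /block_lr /exp_linear -!expRD; congr expR.
  have -> : \sum_g lg g * (block_sum (c g) w - tau) =
      \sum_i Lam i * Z i w - tau * \sum_g lg g.
    under eq_bigr do rewrite mulrBr.
    rewrite sumrB -mulr_suml [X in _ - X]mulrC; congr (_ - _).
    under eq_bigr do rewrite mulr_sumr.
    rewrite (exchange_big_dep xpredT)//=; apply: eq_bigr => i _.
    by rewrite mulr_suml.
  rewrite /k /a -/v -/v'.
  under [in RHS]eq_bigr do rewrite mulrBl mulrDl.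
  by rewrite sumrB big_split/=; ring.
have [ie Ee] := integral_exp_linear nZ indZ a k.
have pw w : 0 <= (block_lr mu c w * trunc tau c w) *
    (block_lr mu c' w * trunc tau c' w) <= exp_linear a k w.
  have /andP[t0 t1] := trunc01 tau c w; have /andP[t0' t1'] := trunc01 tau c' w.
  rewrite !mulr_ge0 ?block_lr_ge0//= -eE mulrACA ler_wpM2l ?mulr_ge0 ?block_lr_ge0//.
  apply: (@le_trans _ _ (trunc tau c w)); first by rewrite ler_piMr.
  case: (boolP [forall g, block_sum (c g) w <= tau]) => [/forallP H|/forallPn[g]].
    apply: (le_trans t1); rewrite -expR0 ler_expR oppr_ge0 sumr_le0// => g _.
    by rewrite mulr_ge0_le0// subr_le0.
  move=> /negP H; rewrite /trunc (bigD1 g)//= indicE memNset// mul0r.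
  exact: expR_ge0.
have il : P.-integrable setT (EFin \o (fun w => (block_lr mu c w * trunc tau c w) *
     (block_lr mu c' w * trunc tau c' w))).
  apply: dominated_integrable pw ie.
  apply: measurable_funM; apply: measurable_funM;
    by [exact: measurable_block_lr|exact: measurable_trunc].
split=> //.
apply: (le_trans (le_Rintegral measurableT il ie (fun w _ => (andP (pw w)).2))).
rewrite Ee.
have -> : \sum_i a i ^+ 2 / 2 - k =
    \sum_i (v i * v' i - (v i + v' i) * Lam i + Lam i ^+ 2 / 2) + tau * \sum_g lg g.
  have -> : \sum_i (v i * v' i - (v i + v' i) * Lam i + Lam i ^+ 2 / 2) =
      \sum_i a i ^+ 2 / 2 - \sum_i v i ^+ 2 / 2 - \sum_i v' i ^+ 2 / 2.
    by rewrite -!sumrB; apply: eq_bigr => i _; rewrite /a; field.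
  by rewrite /k; ring.
rewrite (@sum_support c
  (fun i g => mu * v' i - (mu + v' i) * lg g + lg g ^+ 2 / 2)) //; last 2 first.
- move=> i ic; rewrite /v /mean_of (negbTE ic) mulr0 /Lam big_pred0.
    by rewrite expr0n /=; ring.
  by move=> g; apply/negbTE; apply: contra ic; exact: mem_support.
- move=> i g ig; rewrite /v /mean_of (mem_support ig) mulr1 /Lam (big_pred1 g)// => h.
  by apply/idP/eqP => [ih|->//]; exact: config_disjoint ih ig.
rewrite mulr_sumr -big_split/= expR_sum; apply: ler_prod => g _.
rewrite expR_ge0/= /lg; case: (boolP (hits (c g) c')) => hit; last first.
  rewrite !mulr0 big1 ?addr0 ?expR0// => i ig.
  rewrite /v' /mean_of (_ : i \in _ = false); first by rewrite !mulr0 expr0n/=; ring.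
  by move/negbNE : hit => /disjointFr /(_ ig).
rewrite !mulr1; apply: le_trans hV; rewrite ler_expR.
apply: (@le_trans _ _ (\sum_(i in c g) (mu ^+ 2 - 2 * mu * lam + lam ^+ 2 / 2) + tau * lam)).
  rewrite lerD2r; apply: ler_sum => i _; rewrite /v' /mean_of.
  have mu0 : 0 <= mu by exact: le_trans lammu.
  have := mulr_ge0 mu0 lam0; have : 0 <= mu * (mu - lam) by rewrite mulr_ge0// subr_ge0.
  by rewrite mulrBr -expr2; case: (i \in support c') => /=; rewrite ?mulr1 ?mulr0; lra.
rewrite sumr_const (config_card g cD) -mulr_natr; lra.
Qed.


(** Of the two bounds on the second moment, the first treats every block as
    meeting the other configuration; it is the relevant one when the blocks cover
    a non-vanishing part of all positions. *)
Lemma error_sum_bound mu lam tau V B del (phi : n.-tuple R -> R) :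
  0 <= lam <= mu -> mu * ell%:R <= tau -> 0 <= V ->
  expR (mu ^+ 2 * ell%:R - lam * (2 * mu * ell%:R - tau) + lam ^+ 2 * ell%:R / 2) <= 1 + V ->
  (1 + V) ^+ m <= B \/
    (1 + V * ((2 * (m * ell))%:R / (n - m * ell + 1)%:R)) ^+ m <= B ->
  0 < del -> is_test phi ->
  let eps := m%:R * expR (- (tau - mu * ell%:R) ^+ 2 / (2 * ell%:R)) in
  exists2 x : R, (type1_error Z I phi + type2_error Z I mu phi)%E = (1 + x)%:E &
    `|x| <= eps + del + (B - 1 + 2 * eps) / del.
Proof.
move=> hlam htau V0 hV hB del0 [mphi phi01] eps.
have D0 := block_configs_gt0 model.
have DR0 : 0 < #|D|%:R :> R by rewrite ltr0n.
pose ph w := phi [tuple Z i w | i < n].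
have mph : measurable_fun setT ph.
  by apply: (measurableT_comp mphi); exact: measurable_noise.
have ph01 w : 0 <= ph w <= 1 by exact: phi01.
have iph : P.-integrable setT (EFin \o ph).
  apply: (@dominated_integrable _ _ _ _ _ (cst 1)) => //.
  exact: finite_measure_integrable_cst.
have iLph c : P.-integrable setT (EFin \o (fun w => ph w * block_lr mu c w)).
  apply: dominated_integrable (integral_block_lr mu c).1.
    by apply: measurable_funM => //; exact: measurable_block_lr.
  move=> w; have /andP[p0 p1] := ph01 w.
  by rewrite mulr_ge0 ?block_lr_ge0//= ler_piMl// block_lr_ge0.
have fineE f : P.-integrable setT (EFin \o f) ->
    (\int[P]_w (f w)%:E)%E = (\int[P]_w f w)%:E.
  by move=> fi; rewrite /Rintegral fineK//; exact: integrable_fin_num.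
have E1 : type1_error Z I phi = (\int[P]_w ph w)%:E.
  rewrite /type1_error unlock -fineE//; apply: eq_integral => w _.
  rewrite /ph /observation; congr (phi _)%:E; apply: eq_mktuple => i.
  by rewrite mul0r add0r.
have E2 : type2_error Z I mu phi =
    (1 - #|D|%:R^-1 * \sum_(c in D) \int[P]_w (ph w * block_lr mu c w))%:E.
  rewrite /type2_error unlock.
  rewrite (integral_observation model mu (f := fun x => 1 - phi x)); last 2 first.
  - exact: measurable_funB.
  - by move=> x; have /andP[] := phi01 x; lra.
  have E c : (\int[P]_w
        (1 - phi [tuple (mu * (i \in support c)%:R + Z i w)%R | i < n])%:E)%E =
      (1 - \int[P]_w (ph w * block_lr mu c w))%:E.
    rewrite -(@gaussian_shift _ _ _ P n Z nZ indZ (mean_of mu c)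
      (fun x => (1 - phi x)%:E)); last 2 first.
    - by apply/measurable_EFinP; exact: measurable_funB.
    - by move=> x; rewrite lee_fin; have /andP[] := phi01 x; lra.
    have [iL EL] := integral_block_lr mu c.
    rewrite -[X in (X - _)%:E]EL -RintegralB// -fineE; last first.
      by have := integrableB measurableT iL (iLph c).
    apply: eq_integral => w _; rewrite -EFinM sumrB -mulr_suml.
    rewrite /block_lr /exp_linear -mulr_suml /ph; congr (_%:E); ring.
  under eq_bigr do rewrite E -EFinM.
  rewrite sumEFin -mulr_sumr sumrB sumr_const mulrBr; congr (_ - _)%:E.
  by rewrite -[X in _ * X]mulr_natr mul1r mulVf// gt_eqF.
exists (\int[P]_w ph w - #|D|%:R^-1 * \sum_(c in D) \int[P]_w (ph w * block_lr mu c w)).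
  by rewrite E1 E2 -EFinD; congr (_%:E); ring.
apply: (@truncated_second_moment_bound _ _ _ _ _ D (block_lr mu) (trunc tau)) => //.
- exact: measurable_block_lr.
- exact: block_lr_ge0.
- exact: measurable_trunc.
- exact: trunc01.
- by move=> c _; exact: (integral_block_lr mu c).1.
- by move=> c _; exact: (integral_block_lr mu c).2.
- by move=> c cD; exact: truncation_loss.
- by move=> c c' cD _; exact: (second_moment_pair c' cD hlam V0 hV).1.
rewrite exchange_big/=.
apply: (@le_trans _ _ (\sum_(c' in D) #|D|%:R * B)); last first.
  by rewrite sumr_const -[leLHS]mulr_natl mulrA -expr2 mulrC.
apply: ler_sum => c' c'D.
apply: (@le_trans _ _ (\sum_(c in D) \prod_g (1 + V * (hits (c g) c')%:R))).
  by apply: ler_sum => c cD; exact: (second_moment_pair c' cD hlam V0 hV).2.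
case: hB => hB.
  rewrite mulr_natl -sumr_const; apply: ler_sum => c _; apply: le_trans hB.
  rewrite -[X in _ ^+ X](card_ord m) -prodr_const; apply: ler_prod => g _.
  by case: (hits _ _); rewrite ?mulr1 ?mulr0 ?lexx addr_ge0//= lerD2l.
apply: le_trans (ler_wpM2l (ltW DR0) hB).
exact: config_product_moment.
Qed.

End finite_bound.

(** * Orders of magnitude *)

Section growth.
Context {R : realType}.

(** From exp (- y) >= 1 - y and 1 / (1 - y) <= 1 + 2 y. *)
Lemma expR_le1D2x (y : R) : 0 <= y <= 1 / 2 -> expR y <= 1 + 2 * y.
Proof.
move=> /andP[y0 y1]; have := expR_ge1Dx (- y); rewrite expRN => h.
have p : 0 < 1 - y by lra.
have : expR y <= (1 - y)^-1.
  by rewrite -[leLHS]invrK lef_pV2 ?posrE ?invr_gt0 ?expR_gt0.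
move/le_trans; apply; rewrite -[_^-1]mul1r ler_pdivrMr//.
have : 0 <= y * (1 - 2 * y) by rewrite mulr_ge0//; lra.
lra.
Qed.

Lemma near_powR_small (C c e : R) : 0 < c -> 0 < e ->
  \forall n \near \oo, C * n%:R `^ (- c) <= e.
Proof.
move=> c0 e0; near=> n.
have n0 : 0 < n%:R :> R by rewrite ltr0n; near: n; exact: nbhs_infty_gt.
have h : `|C| / e + 1 <= n%:R `^ c.
  have Ce : 0 <= `|C| / e + 1 by rewrite addr_ge0// divr_ge0// ltW.
  have -> : `|C| / e + 1 = ((`|C| / e + 1) `^ c^-1) `^ c.
    by rewrite -powRrM mulVf ?gt_eqF// powRr1.
  apply: ge0_ler_powR; rewrite ?nnegrE ?powR_ge0//; first exact: ltW.
  by near: n; exact: nbhs_infty_ger.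
rewrite powRN ler_pdivrMr ?powR_gt0//.
apply: (le_trans (ler_norm _)).
rewrite -ler_pdivrMl// mulrC; lra.
Unshelve. all: by end_near. Qed.

Lemma powR_expR (n : nat) (c : R) : (0 < n)%N -> n%:R `^ c = expR (c * ln n%:R).
Proof. by move=> n0; rewrite /powR pnatr_eq0 gtn_eqF. Qed.

Lemma powRD_gt0 (x r s : R) : 0 < x -> x `^ (r + s) = x `^ r * x `^ s.
Proof. by move=> x0; rewrite powRD// (gt_eqF x0) implybT. Qed.

Lemma powR_nat_ge1 (n : nat) (c : R) : (0 < n)%N -> 0 <= c -> 1 <= n%:R `^ c.
Proof.
move=> n0 c0; rewrite powR_expR// -[leLHS]expR0 ler_expR mulr_ge0// ln_ge0//.
by rewrite ler1n.
Qed.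

End growth.

Section block_counts.
Context {R : realType}.
Variables (alpha beta : R) (ell m : nat -> nat).
Hypotheses (halpha : 0 <= alpha < 1) (hab : 0 < alpha + beta <= 1).
Hypothesis hell : forall n, (0 < n)%N -> rounds (ell n) (n%:R `^ alpha).
Hypothesis hm : forall n, (0 < n)%N -> rounds (m n) (n%:R `^ (1 - alpha - beta)).
Hypothesis hfit : forall n, (0 < n)%N -> (m n * ell n <= n)%N.

Lemma ell_bounds n : (0 < n)%N -> (0 < ell n)%N /\ (ell n)%:R <= n%:R `^ alpha + 1.
Proof.
move=> n0; have := hell n0; have /andP[a0 _] := halpha.
have := powR_nat_ge1 n0 a0; rewrite /rounds ltr_norml => h /andP[h1 h2].
split; last by lra.
by rewrite -(ltr0n R); lra.
Qed.

Lemma m_bounds n : (0 < n)%N ->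
  (m n)%:R <= n%:R `^ (1 - alpha - beta) + 1 /\ (m n)%:R <= 2 * n%:R `^ (1 - alpha - beta).
Proof.
move=> n0; have := hm n0; have /andP[_ ab1] := hab.
have b0 : 0 <= 1 - alpha - beta by lra.
have := powR_nat_ge1 n0 b0; rewrite /rounds ltr_norml => h /andP[h1 h2].
by split; lra.
Qed.

Lemma ell_le n : (0 < n)%N -> (ell n)%:R <= 2 * n%:R `^ alpha.
Proof.
move=> n0; have /andP[a0 _] := halpha.
have := powR_nat_ge1 n0 a0; have [_] := ell_bounds n0; lra.
Qed.

Lemma m_le_n n : (0 < n)%N -> (m n)%:R <= n%:R :> R.
Proof.
move=> n0; rewrite ler_nat; apply: leq_trans (hfit n0).
by rewrite leq_pmulr//; have [] := ell_bounds n0.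
Qed.

(** For alpha = 0 rounding leaves [ell n = 1]; for alpha > 0 the rounding error is
    negligible compared with n^alpha. *)
Lemma ell_ratio_cvg : (ell n)%:R / n%:R `^ alpha @[n --> \oo] --> (1 : R).
Proof.
have /andP[a0 _] := halpha.
apply/cvgrPdist_le => e e0; case: (eqVneq alpha 0) => [a0'|an0].
  near=> n.
  have n0 : (0 < n)%N by near: n; exact: nbhs_infty_gt.
  have := hell n0; rewrite /rounds a0' powRr0 divr1 ltr_norml => /andP[_ h].
  suff -> : ell n = 1%N by rewrite subrr normr0 ltW.
  have [l0 _] := ell_bounds n0.
  have : (ell n)%:R < 2%:R :> R by lra.
  by rewrite ltr_nat; case: (ell n) l0 => [|[|]].
have a1 : 0 < alpha by rewrite lt_def an0.
near=> n.
have n0 : (0 < n)%N by near: n; exact: nbhs_infty_gt.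
have pa0 : 0 < n%:R `^ alpha :> R by rewrite powR_gt0// ltr0n.
have small : 1 * n%:R `^ (- alpha) <= e by near: n; exact: near_powR_small.
apply: le_trans small; rewrite mul1r powRN.
have -> : 1 - (ell n)%:R / n%:R `^ alpha = - ((ell n)%:R - n%:R `^ alpha) / n%:R `^ alpha.
  by field; rewrite gt_eqF.
rewrite normrM normrN normfV (gtr0_norm pa0) ler_piMl ?invr_ge0 ?(ltW pa0)//.
exact: ltW (hell n0).
Unshelve. all: by end_near. Qed.

(** m ell is at most (n^b + 1) (n^alpha + 1) with b + alpha = 1 - beta, and all
    four terms of the expanded product are o(n). *)
Lemma near_half_free : 0 < beta ->
  \forall n \near \oo, n%:R / 2 <= (n - m n * ell n + 1)%:R :> R.
Proof.
move=> b0; have /andP[a0 a1] := halpha; have /andP[ab0 ab1] := hab.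
have a1' : 0 < 1 - alpha by lra.
near=> n.
have n0 : (0 < n)%N by near: n; exact: nbhs_infty_gt.
have N0 : 0 < n%:R :> R by rewrite ltr0n.
have h1 : 8 * n%:R `^ (- beta) <= 1 :> R by near: n; exact: near_powR_small.
have h2 : 8 * n%:R `^ (- (alpha + beta)) <= 1 :> R by near: n; exact: near_powR_small.
have h3 : 8 * n%:R `^ (- (1 - alpha)) <= 1 :> R by near: n; exact: near_powR_small.
have h4 : 8 <= n%:R :> R by near: n; exact: nbhs_infty_ger.
have split_pow c : n%:R `^ c = n%:R * n%:R `^ (c - 1) :> R.
  rewrite -[in LHS](subrKC 1 c) [LHS]powRD_gt0//.
  by rewrite powRr1// ltW.
have [_ hl] := ell_bounds n0; have [hmn _] := m_bounds n0.
have hml : (m n)%:R * (ell n)%:R <= (n%:R `^ (1 - alpha - beta) + 1) * (n%:R `^ alpha + 1) :> R.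
  by rewrite ler_pM.
rewrite natrD natrB ?hfit// natrM.
have e1 : n%:R `^ (1 - alpha - beta) * n%:R `^ alpha = n%:R * n%:R `^ (- beta) :> R.
  rewrite -powRD_gt0//.
  by rewrite split_pow; congr (_ * powR _ _); ring.
have e2 : n%:R `^ (1 - alpha - beta) = n%:R * n%:R `^ (- (alpha + beta)) :> R.
  by rewrite split_pow; congr (_ * powR _ _); ring.
have e3 : n%:R `^ alpha = n%:R * n%:R `^ (- (1 - alpha)) :> R.
  by rewrite split_pow; congr (_ * powR _ _); ring.
have k1 : n%:R * (8 * n%:R `^ (- beta)) <= n%:R * 1 :> R by rewrite ler_pM2l.
have k2 : n%:R * (8 * n%:R `^ (- (alpha + beta))) <= n%:R * 1 :> R by rewrite ler_pM2l.
have k3 : n%:R * (8 * n%:R `^ (- (1 - alpha))) <= n%:R * 1 :> R by rewrite ler_pM2l.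
rewrite mulrDl mulrDr e1 mulr1 mul1r e2 e3 in hml.
lra.
Unshelve. all: by end_near. Qed.

(** The left-hand side, of order m^2 ell / n, bounds the expected number of blocks
    of one configuration that meet another one. *)
Lemma near_fill_bound : 0 < beta -> \forall n \near \oo,
  (m n)%:R * ((2 * (m n * ell n))%:R / (n - m n * ell n + 1)%:R) <=
    32 * n%:R `^ (2 * (1 - alpha - beta) - (1 - alpha)) :> R.
Proof.
move=> b0; near=> n.
have n0 : (0 < n)%N by near: n; exact: nbhs_infty_gt.
have N0 : 0 < n%:R :> R by rewrite ltr0n.
have hD : n%:R / 2 <= (n - m n * ell n + 1)%:R :> R by near: n; exact: near_half_free.
have D0 : 0 < (n - m n * ell n + 1)%:R :> R by rewrite ltr0n addn1.
have [_ hmn] := m_bounds n0; have hl := ell_le n0.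
set b := 1 - alpha - beta in hmn *.
rewrite mulrA ler_pdivrMr//.
apply: (@le_trans _ _ (32 * n%:R `^ (2 * b - (1 - alpha)) * (n%:R / 2))); last first.
  by rewrite ler_wpM2l// mulr_ge0// powR_ge0.
have -> : 32 * n%:R `^ (2 * b - (1 - alpha)) * (n%:R / 2) =
    (2 * n%:R `^ b) * (2 * ((2 * n%:R `^ b) * (2 * n%:R `^ alpha))) :> R.
  have : n%:R `^ (2 * b - (1 - alpha)) * n%:R = n%:R `^ b * n%:R `^ b * n%:R `^ alpha :> R.
    rewrite -!powRD_gt0//.
    have -> : b + b + alpha = (2 * b - (1 - alpha)) + 1 by ring.
    by rewrite [RHS]powRD_gt0// powRr1// ltW.
  move=> E; rewrite (_ : 32 * _ * _ =
    16 * (n%:R `^ (2 * b - (1 - alpha)) * n%:R)); last by field.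
  rewrite E; ring.
rewrite !natrM ler_pM ?mulr_ge0//.
by rewrite ler_wpM2l// ler_pM.
Unshelve. all: by end_near. Qed.

End block_counts.

(** * From the error bound to merging *)

Section scaled.
Context d (T : measurableType d) (R : realType) (P : probability T R).
Variables (n m ell : nat) (Z : 'I_n -> {RV P >-> R}) (I : T -> {ffun 'I_m -> {set 'I_n}}).
Hypothesis model : multiple_blocks_model ell Z I.
Hypothesis ell0 : (0 < ell)%N.
Hypothesis fit : (m * ell <= n)%N.

(** [error_sum_bound] in the scale-free parameters s = mu sqrt ell,
    k = lam sqrt ell and t = tau / sqrt ell, with the second moment bounded
    through (1 + y)^m <= exp (m y). *)
Lemma error_sum_bound_scaled mu k t V e del (phi : n.-tuple R -> R) :
  let s := mu * Num.sqrt ell%:R in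
  0 <= k <= s -> s <= t -> 0 <= V ->
  expR (s ^+ 2 - k * (2 * s - t) + k ^+ 2 / 2) <= 1 + V ->
  m%:R * expR (- (t - s) ^+ 2 / 2) <= e ->
  m%:R * V <= e \/
    m%:R * ((2 * (m * ell))%:R / (n - m * ell + 1)%:R) * V <= e ->
  0 < del -> is_test phi ->
  exists2 x : R, (type1_error Z I phi + type2_error Z I mu phi)%E = (1 + x)%:E &
    `|x| <= e + del + (expR e - 1 + 2 * e) / del.
Proof.
move=> s /andP[k0 ks] st V0 hV he hB del0 tphi.
pose q : R := Num.sqrt ell%:R.
have l0 : 0 < ell%:R :> R by rewrite ltr0n.
have q0 : 0 < q by rewrite sqrtr_gt0.
have q2 : ell%:R = q ^+ 2 by rewrite sqr_sqrtr// ltW.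
have sE : s = mu * q by [].
have muE : mu = s / q by rewrite sE mulfK// gt_eqF.
have pow1 (y : R) : 0 <= y -> m%:R * y <= e -> (1 + y) ^+ m <= expR e.
  move=> y0 my; apply: (@le_trans _ _ (expR y ^+ m)).
    by rewrite lerXn2r ?nnegrE ?expR_ge0 ?addr_ge0 ?expR_ge1Dx.
  by rewrite -expRM_natr ler_expR mulrC.
have [] := @error_sum_bound _ _ _ P n m ell Z I model ell0 fit
  mu (k / q) (t * q) V (expR e) del phi.
- by rewrite divr_ge0 ?(ltW q0)//= muE ler_pM2r ?invr_gt0.
- rewrite muE q2 (_ : s / q * q ^+ 2 = s * q); last by field; rewrite gt_eqF.
  by rewrite ler_pM2r.
- by [].
- apply: le_trans hV; rewrite le_eqVlt; apply/orP; left; apply/eqP; congr expR.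
  by rewrite muE q2; field; rewrite gt_eqF.
- case: hB => hB; [left|right]; apply: pow1 => //.
    by rewrite mulr_ge0// divr_ge0.
  by rewrite mulrA mulrAC.
- exact: del0.
- exact: tphi.
move=> x Ex hx; exists x => //; apply: (le_trans hx).
have E : m%:R * expR (- (t * q - mu * ell%:R) ^+ 2 / (2 * ell%:R)) <= e.
  apply: le_trans he; rewrite le_eqVlt; apply/orP; left; apply/eqP; congr (_ * expR _).
  by rewrite muE q2; field; rewrite gt_eqF.
have di : 0 < del^-1 by rewrite invr_gt0.
set ep := m%:R * _ in E *.
rewrite !lerD// ler_pM2r// lerD2l ler_pM2l//.
Qed.

End scaled.

Section merging.
Context {R : realType}.
Variables (ell m : nat -> nat).
Variables (d : nat -> measure_display) (T : forall n, measurableType (d n))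
    (P : forall n, probability (T n) R)
    (Z : forall n, 'I_n -> {RV (P n) >-> R})
    (I : forall n, T n -> {ffun 'I_(m n) -> {set 'I_n}}).
Hypothesis hmodel : forall n, (0 < n)%N -> multiple_blocks_model (ell n) (@Z n) (@I n).
Hypothesis hell0 : forall n, (0 < n)%N -> (0 < ell n)%N.
Hypothesis hfit : forall n, (0 < n)%N -> (m n * ell n <= n)%N.

Lemma merge_criterion (mu s k t V : nat -> R) :
  (\forall n \near \oo, mu n * Num.sqrt (ell n)%:R = s n) ->
  (\forall n \near \oo, 0 <= k n <= s n) ->
  (\forall n \near \oo, s n <= t n) ->
  (\forall n \near \oo, 0 <= V n) ->
  (\forall n \near \oo,
     expR (s n ^+ 2 - k n * (2 * s n - t n) + k n ^+ 2 / 2) <= 1 + V n) ->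
  (forall e, 0 < e -> \forall n \near \oo,
     (m n)%:R * expR (- (t n - s n) ^+ 2 / 2) <= e) ->
  (forall e, 0 < e -> \forall n \near \oo, (m n)%:R * V n <= e) \/
  (forall e, 0 < e -> \forall n \near \oo,
     (m n)%:R * ((2 * (m n * ell n))%:R / (n - m n * ell n + 1)%:R) * V n <= e) ->
  merge_asymptotically (@Z) (@I) mu.
Proof.
move=> hs hk ht hV0 hV he hB phi tphi.
have key eta : 0 < eta -> \forall n \near \oo, exists2 x : R,
    (type1_error (@Z n) (@I n) (phi n) +
       type2_error (@Z n) (@I n) (mu n) (phi n))%E = (1 + x)%:E &
    `|x| <= eta.
  move=> eta0.
  (* With del = eta / 4, each of the three terms of the bound is then at most
     eta / 4; the last one is at most 4 e / del. *)
  pose e := Num.min (1 / 2) (Num.min (eta / 4) (eta ^+ 2 / 64)).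
  have e0 : 0 < e by rewrite !lt_min divr_gt0//= !divr_gt0// exprn_gt0.
  have e1 : e <= 1 / 2 by rewrite ge_min lexx.
  have e2 : e <= eta / 4 by rewrite !ge_min lexx orbT.
  have e3 : e <= eta ^+ 2 / 64 by rewrite !ge_min lexx !orbT.
  have hB' : \forall n \near \oo, (m n)%:R * V n <= e \/
     (m n)%:R * ((2 * (m n * ell n))%:R / (n - m n * ell n + 1)%:R) * V n <= e.
    by case: hB => /(_ _ e0) h; near=> n; [left|right]; near: n.
  have hee := he _ e0.
  near=> n.
  have n0 : (0 < n)%N by near: n; exact: nbhs_infty_gt.
  have sn : mu n * Num.sqrt (ell n)%:R = s n by near: n.
  have del0 : 0 < eta / 4 by rewrite divr_gt0.
  have [] := @error_sum_bound_scaled _ _ _ (P n) n (m n) (ell n) (@Z n) (@I n)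
    (hmodel n0) (hell0 n0) (hfit n0) (mu n) (k n) (t n) (V n) e (eta / 4) (phi n).
  - by rewrite sn; near: n.
  - by rewrite sn; near: n.
  - by near: n.
  - by rewrite sn; near: n.
  - by rewrite sn; near: n.
  - by near: n.
  - exact: del0.
  - exact: tphi.
  move=> x Ex hx; exists x => //; apply: (le_trans hx).
  have ex : expR e <= 1 + 2 * e by apply: expR_le1D2x; rewrite (ltW e0).
  have : (expR e - 1 + 2 * e) / (eta / 4) <= eta / 4.
    rewrite ler_pdivrMr//; apply: (@le_trans _ _ (eta ^+ 2 / 16)); first lra.
    by rewrite le_eqVlt; apply/orP; left; apply/eqP; field.
  lra.
apply/fine_cvgP; split.
  have := key 1 ltr01; apply: filterS => n [x -> _]//.
apply/cvgrPdist_le => eta eta0; have := key eta eta0; apply: filterS => n [x E hx] /=.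
by rewrite E /= opprD addrA subrr sub0r normrN.
Unshelve. all: by end_near. Qed.

End merging.

(** * The sparse and dense regimes *)

Section regimes.
Context {R : realType}.
Variables (alpha beta : R) (ell m : nat -> nat).
Hypotheses (halpha : 0 <= alpha < 1) (hab : 0 < alpha + beta <= 1).
Hypothesis hell : forall n, (0 < n)%N -> rounds (ell n) (n%:R `^ alpha).
Hypothesis hm : forall n, (0 < n)%N -> rounds (m n) (n%:R `^ (1 - alpha - beta)).
Hypothesis hfit : forall n, (0 < n)%N -> (m n * ell n <= n)%N.
Variables (d : nat -> measure_display) (T : forall n, measurableType (d n))
    (P : forall n, probability (T n) R)
    (Z : forall n, 'I_n -> {RV (P n) >-> R})
    (I : forall n, T n -> {ffun 'I_(m n) -> {set 'I_n}}).
Hypothesis hmodel : forall n, (0 < n)%N -> multiple_blocks_model (ell n) (@Z n) (@I n).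

Let hell0 n (n0 : (0 < n)%N) := (ell_bounds halpha hell n0).1.

Local Notation a := (1 - alpha).
Local Notation b := (1 - alpha - beta).

(** In the sparse case mu sqrt ell = sqrt (2 log n) * [rel_signal r n]; this would
    be the constant sqrt r if n^alpha were an integer. *)
Definition rel_signal (r : R) (n : nat) : R := Num.sqrt (r * ((ell n)%:R / n%:R `^ alpha)).

Lemma rel_signal_cvg (r : R) : rel_signal r n @[n --> \oo] --> Num.sqrt r.
Proof.
have h : r * ((ell n)%:R / n%:R `^ alpha) @[n --> \oo] --> r.
  rewrite -[X in _ --> X]mulr1; apply: cvgM; first exact: cvg_cst.
  exact: ell_ratio_cvg halpha hell.
exact: (cvg_comp _ _ h (@sqrt_continuous R r)).
Qed.

Lemma mu_sparse_scaled r n : 0 < r -> (0 < n)%N ->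
  mu_sparse alpha r n * Num.sqrt (ell n)%:R = Num.sqrt (2 * ln n%:R) * rel_signal r n.
Proof.
move=> r0 n0.
have x0 : 0 <= ln n%:R :> R by rewrite ln_ge0// ler1n.
have p0 : 0 < n%:R `^ alpha :> R by rewrite powR_gt0// ltr0n.
rewrite /mu_sparse /rel_signal -sqrtrV ?(ltW p0)// -!sqrtrM ?mulr_ge0 ?(ltW r0)//.
by congr Num.sqrt; ring.
Qed.

(** All parameters are multiples of sqrt (2 log n), which turns the exponentials of
    [merge_criterion] into powers of n: the third hypothesis bounds the exponent
    of the truncation loss, the fourth that of the excess second moment. *)
Lemma sparse_merge (r del : R) (kap tht : nat -> R) : 0 < r -> 0 < beta -> 0 < del ->
  (\forall n \near \oo, 0 <= kap n <= rel_signal r n) ->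
  (\forall n \near \oo, rel_signal r n <= tht n) ->
  (\forall n \near \oo, b - (tht n - rel_signal r n) ^+ 2 <= - del) ->
  (\forall n \near \oo, 2 * b - a + (2 * rel_signal r n ^+ 2
      - 2 * kap n * (2 * rel_signal r n - tht n) + kap n ^+ 2) <= - del) ->
  merge_asymptotically (@Z) (@I) (mu_sparse alpha r).
Proof.
move=> r0 b0 del0 hk ht he hB.
pose y n := 2 * rel_signal r n ^+ 2 - 2 * kap n * (2 * rel_signal r n - tht n) + kap n ^+ 2.
have lnE (n : nat) : (0 < n)%N -> Num.sqrt (2 * ln n%:R) ^+ 2 = 2 * ln n%:R :> R.
  by move=> n0; rewrite sqr_sqrtr// mulr_ge0// ln_ge0// ler1n.
apply: (@merge_criterion _ ell m d T P (@Z) (@I) hmodel hell0 hfit _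
  (fun n => Num.sqrt (2 * ln n%:R) * rel_signal r n)
  (fun n => Num.sqrt (2 * ln n%:R) * kap n)
  (fun n => Num.sqrt (2 * ln n%:R) * tht n) (fun n => n%:R `^ y n)).
- near=> n; apply: mu_sparse_scaled => //; near: n; exact: nbhs_infty_gt.
- near=> n; have : 0 <= kap n <= rel_signal r n by near: n.
  by move=> /andP[k0 k1]; rewrite mulr_ge0 ?sqrtr_ge0//= ler_wpM2l// sqrtr_ge0.
- near=> n; rewrite ler_wpM2l ?sqrtr_ge0//; by near: n.
- by near=> n; exact: powR_ge0.
- near=> n; have n0 : (0 < n)%N by near: n; exact: nbhs_infty_gt.
  rewrite powR_expR// -[leLHS]add0r lerD// le_eqVlt; apply/orP; left; apply/eqP; congr expR.
  rewrite /y !exprMn; set S := Num.sqrt _.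
  have S2 : S ^+ 2 = 2 * ln n%:R by exact: lnE.
  transitivity (S ^+ 2 * (rel_signal r n ^+ 2
    - kap n * (2 * rel_signal r n - tht n) + kap n ^+ 2 / 2)).
    by field.
  by rewrite S2; field.
- move=> e e0; near=> n.
  have n0 : (0 < n)%N by near: n; exact: nbhs_infty_gt.
  have n1 : 1 <= n%:R :> R by rewrite ler1n.
  have small : 2 * n%:R `^ (- del) <= e by near: n; exact: near_powR_small.
  apply: le_trans small; have [_ mb] := m_bounds hab hm n0.
  have hen : b - (tht n - rel_signal r n) ^+ 2 <= - del by near: n.
  have -> : expR (- (Num.sqrt (2 * ln n%:R) * tht n
      - Num.sqrt (2 * ln n%:R) * rel_signal r n) ^+ 2 / 2) =
      n%:R `^ (- (tht n - rel_signal r n) ^+ 2).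
    by rewrite powR_expR// -mulrBr exprMn lnE//; congr expR; field.
  apply: (@le_trans _ _ (2 * n%:R `^ b * n%:R `^ (- (tht n - rel_signal r n) ^+ 2))).
    by rewrite ler_wpM2r// powR_ge0.
  by rewrite -mulrA -powRD_gt0 ?ltr0n// ler_wpM2l// ler_powR.
- right=> e e0; near=> n.
  have n0 : (0 < n)%N by near: n; exact: nbhs_infty_gt.
  have n1 : 1 <= n%:R :> R by rewrite ler1n.
  have small : 32 * n%:R `^ (- del) <= e by near: n; exact: near_powR_small.
  apply: le_trans small.
  have hBn : 2 * b - a + y n <= - del by near: n.
  have fb : (m n)%:R * ((2 * (m n * ell n))%:R / (n - m n * ell n + 1)%:R) <=
      32 * n%:R `^ (2 * b - a) :> R by near: n; exact: near_fill_bound.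
  apply: (@le_trans _ _ (32 * n%:R `^ (2 * b - a) * n%:R `^ y n)).
    by rewrite ler_wpM2r// powR_ge0.
  by rewrite -mulrA -powRD_gt0 ?ltr0n// ler_wpM2l// ler_powR.
Unshelve. all: by end_near. Qed.

(** Here lam = 0, so the threshold does not enter the second moment and can be
    placed so high that the truncation loss is at most of order n^(b - 4). *)
Lemma sparse_merge_untruncated (r : R) : 0 < r -> 0 < beta -> 2 * b - a + 2 * r < 0 ->
  merge_asymptotically (@Z) (@I) (mu_sparse alpha r).
Proof.
move=> r0 b0 hr; have /andP[a0 a1] := halpha; have /andP[ab0 ab1] := hab.
have cv : rel_signal r n @[n --> \oo] --> Num.sqrt r by exact: rel_signal_cvg.
pose del := Num.min 1 (- (2 * b - a + 2 * r) / 2).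
have d1 : del <= 1 by rewrite ge_min lexx.
have d2 : del <= - (2 * b - a + 2 * r) / 2 by rewrite ge_min lexx orbT.
have del0 : 0 < del by rewrite lt_min ltr01/= divr_gt0// oppr_gt0.
apply: (@sparse_merge r del (fun=> 0) (fun n => rel_signal r n + 2)) => //.
- by near=> n; rewrite lexx sqrtr_ge0.
- by near=> n; rewrite lerDl.
- near=> n; rewrite (_ : rel_signal r n + 2 - rel_signal r n = 2); last by ring.
  lra.
- have cv2 : rel_signal r n ^+ 2 @[n --> \oo] --> r.
    rewrite -[X in _ --> X](sqr_sqrtr (ltW r0)); exact: (cvgM cv cv).
  have := @cvgr_le _ _ _ _ _ _ cv2 (r + del / 2).
  have rd : r < r + del / 2 by rewrite ltrDl divr_gt0.
  move=> /(_ _ rd) h; near=> n.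
  have : rel_signal r n ^+ 2 <= r + del / 2 by near: n.
  rewrite !mulr0 expr0n/= !mul0r addr0 subr0; lra.
Unshelve. all: by end_near. Qed.

(** The threshold sqrt (2 a log n) is about the maximum of n / ell independent
    normal variables, and k = 2 s - t is the best Chernoff exponent; the bounds
    sqrt a < 2 sqrt r and sqrt r < sqrt a give 0 <= k <= s for large n. *)
Lemma sparse_merge_truncated (r : R) : 0 < r -> 0 < beta ->
  Num.sqrt a < 2 * Num.sqrt r -> Num.sqrt r < Num.sqrt a ->
  b < (Num.sqrt a - Num.sqrt r) ^+ 2 ->
  merge_asymptotically (@Z) (@I) (mu_sparse alpha r).
Proof.
move=> r0 b0 h1 h2 h3; have /andP[a0 a1] := halpha.
have cv : rel_signal r n @[n --> \oo] --> Num.sqrt r by exact: rel_signal_cvg.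
pose del := ((Num.sqrt a - Num.sqrt r) ^+ 2 - b) / 2.
have del0 : 0 < del by rewrite divr_gt0// subr_gt0.
have a2 : Num.sqrt a ^+ 2 = a by rewrite sqr_sqrtr//; lra.
have cva : Num.sqrt a - rel_signal r n @[n --> \oo] --> Num.sqrt a - Num.sqrt r.
  by apply: cvgB => //; exact: cvg_cst.
have cva2 : (Num.sqrt a - rel_signal r n) ^+ 2 @[n --> \oo] --> (Num.sqrt a - Num.sqrt r) ^+ 2.
  exact: (cvgM cva cva).
have gt1 : \forall n \near \oo, b + del < (Num.sqrt a - rel_signal r n) ^+ 2.
  by apply: (cvgr_gt _ cva2); rewrite /del; lra.
have lt2 : \forall n \near \oo, rel_signal r n < Num.sqrt a by exact: (cvgr_lt _ cv).
have gt3 : \forall n \near \oo, Num.sqrt a / 2 < rel_signal r n.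
  by apply: (cvgr_gt _ cv); lra.
apply: (@sparse_merge r del (fun n => 2 * rel_signal r n - Num.sqrt a)
  (fun=> Num.sqrt a)) => //.
- near=> n.
  have : rel_signal r n < Num.sqrt a by near: n.
  have : Num.sqrt a / 2 < rel_signal r n by near: n.
  by move=> ? ?; apply/andP; split; lra.
- by near=> n; apply: ltW; near: n.
- near=> n; have : b + del < (Num.sqrt a - rel_signal r n) ^+ 2 by near: n.
  lra.
- near=> n; have : b + del < (Num.sqrt a - rel_signal r n) ^+ 2 by near: n.
  move=> ?; rewrite (_ : _ + _ = 2 * b - a + Num.sqrt a ^+ 2
    - 2 * (Num.sqrt a - rel_signal r n) ^+ 2); last by ring.
  rewrite a2; lra.
Unshelve. all: by end_near. Qed.

(** Now mu^2 ell tends to 0, and V = 2 mu^2 ell takes the place of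
    exp (mu^2 ell) - 1.  For beta > 0 the exponent of the excess second moment is
    2 b - a + 2 r, and for beta <= 0 the cruder count gives b + 2 r < beta. *)
Lemma dense_merge (r : R) : beta / a < 1 / 2 -> r < rho_dense alpha beta ->
  merge_asymptotically (@Z) (@I) (mu_dense alpha r).
Proof.
rewrite /rho_dense => hd hr; have /andP[a0 a1] := halpha; have /andP[ab0 ab1] := hab.
have apos : 0 < a by lra.
have hd' : beta < a / 2 by move: hd; rewrite ltr_pdivrMr//; lra.
have r0 : r < 0 by lra.
pose s n : R := n%:R `^ r * Num.sqrt ((ell n)%:R / n%:R `^ alpha).
have s0 n : 0 <= s n by rewrite mulr_ge0 ?powR_ge0 ?sqrtr_ge0.
have s2 n : (0 < n)%N -> s n ^+ 2 <= 2 * n%:R `^ (2 * r).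
  move=> n0; have p0 : 0 < n%:R `^ alpha :> R by rewrite powR_gt0// ltr0n.
  rewrite /s exprMn sqr_sqrtr ?divr_ge0 ?(ltW p0)//.
  have -> : (n%:R `^ r) ^+ 2 = n%:R `^ (2 * r) :> R.
    by rewrite expr2 -powRD_gt0 ?ltr0n//; congr powR; ring.
  by rewrite mulrC ler_wpM2r ?powR_ge0// ler_pdivrMr//; exact: ell_le.
have V4 n : (0 < n)%N -> 2 * s n ^+ 2 <= 4 * n%:R `^ (2 * r).
  by move=> /s2; lra.
apply: (@merge_criterion _ ell m d T P (@Z) (@I) hmodel hell0 hfit _
  s (fun=> 0) (fun n => s n + 2 * Num.sqrt (2 * ln n%:R)) (fun n => 2 * s n ^+ 2)).
- near=> n; have n0 : (0 < n)%N by near: n; exact: nbhs_infty_gt.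
  have p0 : 0 < n%:R `^ alpha :> R by rewrite powR_gt0// ltr0n.
  by rewrite /mu_dense /s -mulrA; congr (_ * _); rewrite [in RHS]sqrtrM// mulrC sqrtrV ?(ltW p0).
- by near=> n; rewrite lexx s0.
- by near=> n; rewrite lerDl mulr_ge0// sqrtr_ge0.
- by near=> n; rewrite mulr_ge0// exprn_ge0.
- near=> n; have n0 : (0 < n)%N by near: n; exact: nbhs_infty_gt.
  rewrite mul0r expr0n/= mul0r subr0 addr0; apply: expR_le1D2x.
  rewrite exprn_ge0//=; apply: le_trans (s2 _ n0) _.
  have -> : 2 * r = - (- (2 * r)) by rewrite opprK.
  by near: n; apply: near_powR_small; lra.
- move=> e e0; near=> n; have n0 : (0 < n)%N by near: n; exact: nbhs_infty_gt.
  have small : 1 * n%:R `^ (- 3) <= e by near: n; exact: near_powR_small.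
  apply: le_trans small.
  have -> : expR (- (s n + 2 * Num.sqrt (2 * ln n%:R) - s n) ^+ 2 / 2) = n%:R `^ (- 4).
    rewrite powR_expR//.
    rewrite (_ : s n + 2 * Num.sqrt (2 * ln n%:R) - s n =
      2 * Num.sqrt (2 * ln n%:R)); last by ring.
    rewrite exprMn sqr_sqrtr; last by rewrite mulr_ge0// ln_ge0// ler1n.
    by congr expR; field.
  rewrite mul1r (_ : - 3 = 1 + - 4); last by ring.
  rewrite powRD_gt0 ?ltr0n// powRr1 ?ler0n// ler_wpM2r ?powR_ge0//.
  exact: (m_le_n halpha hell hfit n0).
- have [b0|b0] := ltP 0 beta.
    right=> e e0; near=> n; have n0 : (0 < n)%N by near: n; exact: nbhs_infty_gt.
    have small : 128 * n%:R `^ (- (- (2 * b - a + 2 * r))) <= e.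
      by near: n; apply: near_powR_small => //; lra.
    apply: le_trans small; rewrite opprK.
    have fb : (m n)%:R * ((2 * (m n * ell n))%:R / (n - m n * ell n + 1)%:R) <=
      32 * n%:R `^ (2 * b - a) :> R by near: n; exact: near_fill_bound.
    apply: (@le_trans _ _ (32 * n%:R `^ (2 * b - a) * (4 * n%:R `^ (2 * r)))).
      by rewrite ler_pM ?V4 ?mulr_ge0 ?divr_ge0 ?exprn_ge0.
    by rewrite mulrACA -powRD_gt0 ?ltr0n// -natrM.
  left=> e e0; near=> n; have n0 : (0 < n)%N by near: n; exact: nbhs_infty_gt.
  have small : 8 * n%:R `^ (- (- (b + 2 * r))) <= e.
    by near: n; apply: near_powR_small => //; lra.
  apply: le_trans small; rewrite opprK.
  have [_ mb] := m_bounds hab hm n0.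
  apply: (@le_trans _ _ ((2 * n%:R `^ b) * (4 * n%:R `^ (2 * r)))).
    by rewrite ler_pM ?V4 ?mulr_ge0 ?exprn_ge0.
  by rewrite mulrACA -powRD_gt0 ?ltr0n// -natrM.
Unshelve. all: by end_near. Qed.

End regimes.

Theorem theorem2p1 (R : realType) (alpha beta : R)
    (halpha : 0 <= alpha < 1) (hab : 0 < alpha + beta <= 1)
    (ell m : nat -> nat)
    (hell : forall n, (0 < n)%N -> rounds (ell n) (n%:R `^ alpha))
    (hm : forall n, (0 < n)%N -> rounds (m n) (n%:R `^ (1 - alpha - beta)))
    (hfit : forall n, (0 < n)%N -> (m n * ell n <= n)%N)
    (d : nat -> measure_display) (T : forall n, measurableType (d n))
    (P : forall n, probability (T n) R)
    (Z : forall n, 'I_n -> {RV (P n) >-> R})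
    (I : forall n, T n -> {ffun 'I_(m n) -> {set 'I_n}})
    (hmodel : forall n, (0 < n)%N ->
       multiple_blocks_model (ell n) (Z n) (I n))
    (r : R) :
  (1 / 2 < beta / (1 - alpha) -> 0 < r -> r < rho_sparse alpha beta ->
     merge_asymptotically Z I (mu_sparse alpha r)) /\
  (beta / (1 - alpha) < 1 / 2 -> r < rho_dense alpha beta ->
     merge_asymptotically Z I (mu_dense alpha r)).
Proof.
split; last exact: (dense_merge halpha hab hell hm hfit hmodel).
move=> hs r0; have /andP[a0 a1] := halpha; have /andP[ab0 ab1] := hab.
have apos : 0 < 1 - alpha by lra.
have b0 : 0 < beta by move: hs; rewrite ltr_pdivlMr//; lra.
rewrite /rho_sparse ltr_pdivrMr//; case: (ltP beta (3 / 4 * (1 - alpha))) => hb hr.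
  by apply: (sparse_merge_untruncated halpha hab hell hm hfit hmodel) => //; lra.
set A := Num.sqrt (1 - alpha) in hr; set B := Num.sqrt (1 - alpha - beta) in hr.
have A2 : A ^+ 2 = 1 - alpha by rewrite sqr_sqrtr//; lra.
have B2 : B ^+ 2 = 1 - alpha - beta by rewrite sqr_sqrtr//; lra.
have A0 : 0 < A by rewrite sqrtr_gt0.
have B0 : 0 <= B by rewrite sqrtr_ge0.
have BA : 2 * B <= A.
  by rewrite -(ler_pXn2r (n := 2))// ?nnegrE ?mulr_ge0 ?(ltW A0)// exprMn A2 B2; lra.
pose S := Num.sqrt r.
have S2 : S ^+ 2 = r by rewrite sqr_sqrtr// ltW.
have S0 : 0 < S by rewrite sqrtr_gt0.
have SAB : S < A - B.
  by rewrite -(ltr_pXn2r (n := 2))// ?nnegrE ?(ltW S0) ?S2 ?subr_ge0//; lra.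
(* For 2 sqrt r <= sqrt a the untruncated bound suffices: r and b are both at
   most a / 4, and equality in both would contradict sqrt r < sqrt a - sqrt b. *)
have [SA|SA] := ltP A (2 * S).
  apply: (sparse_merge_truncated halpha hab hell hm hfit hmodel) => //; rewrite -/A -/S; first lra.
  by rewrite -B2 ltr_pXn2r// ?nnegrE//; lra.
apply: (sparse_merge_untruncated halpha hab hell hm hfit hmodel) => //.
rewrite -B2 -A2 -S2.
have h1 : S ^+ 2 <= (A / 2) ^+ 2 by rewrite ler_pXn2r ?nnegrE ?(ltW S0)//; lra.
have h2 : B ^+ 2 <= (A / 2) ^+ 2 by rewrite ler_pXn2r ?nnegrE//; lra.
nra.
Qed.
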